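(* Let $p$ be a fixed positive integer, and let $\varphi(z) = \sum_{k=0}^\infty \frac{\gamma_k}{k!} z^k = \sum_{k=0}^\infty a_k z^k$ be a function in the class $\mathscr{L}\text{-}\mathscr{P}^+$. For $k = 0,1,2,\dots$ let $$L_k^p := \binom{2p-1}{p} a_k^2 + \sum_{j=1}^p (-1)^j \binom{2p}{p-j} a_{k-j}a_{k+j},$$ where $a_i = 0$ for $i<0$. Then the function $$L_k^p[\varphi(z)] := \sum_{k=0}^\infty L_k^p\, z^k$$ belongs to $\mathscr{L}\text{-}\mathscr{P}^+$.
   Context: A real entire function belongs to the Laguerre-P\'olya class $\mathscr{L}\text{-}\mathscr{P}$ if it is the uniform limit, on compact subsets of $\mathbb{C}$, of real polynomials all of whose zeros are real. The class $\mathscr{L}\text{-}\mathscr{P}^+$ consists of precisely those functions in $\mathscr{L}\text{-}\mathscr{P}$ whose Taylor coefficients (at the origin) are all non-negative. Convention: $a_k = 0$ for negative $k$, and if the function is a polynomial, $a_k=0$ for $k$ larger than its degree. The notation $L_k^p[\varphi(z)]$ denotes the power series $\sum_k L_k^p z^k$ obtained by applying the non-linear operator $a_k\mapsto L_k^p$ to the coefficients of $\varphi$ (here $k$ is a summation index). *)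

(* Defs.v *)
From HB Require Import structures.
From mathcomp Require Import all_boot all_order all_algebra.
From mathcomp Require Import all_classical all_reals all_analysis.
From mathcomp Require Import complex.

Set Implicit Arguments.
Unset Strict Implicit.
Unset Printing Implicit Defensive.

Import Order.TTheory GRing.Theory Num.Theory.
Import numFieldNormedType.Exports.

Local Open Scope classical_set_scope.
Local Open Scope complex_scope.
Local Open Scope ring_scope.

(* The complex plane is R[i]^o: R[i] itself carries no topology in the
   libraries, whereas the regular module R[i]^o is a normed module over R[i]. *)

(* The order of R[i] is partial: 0 <= z means that z is real and nonnegative,
   and z \is Num.real means that z is real. *)

Definition entire (R : realType) (f : R[i]^o -> R[i]^o) : Prop :=
  forall z : R[i]^o, derivable f z 1.

Definition real_entire (R : realType) (f : R[i]^o -> R[i]^o) : Prop :=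
  entire f /\ forall x : R, (f x%:C : R[i]) \is Num.real.

Definition taylor_coef (R : realType) (f : R[i]^o -> R[i]^o) (k : nat) : R[i] :=
  derive1n k f (0 : R[i]^o) / k`!%:R.

Definition complex_poly (R : realType) (q : {poly R}) : {poly R[i]} :=
  map_poly (real_complex R) q.

(* The zero polynomial does not satisfy this, but the constants 1 / n.+1 do,
   so the zero function still is in the class LP. *)
Definition real_rooted (R : realType) (q : {poly R}) : Prop :=
  forall z : R[i], root (complex_poly q) z -> z \is Num.real.

Definition LP (R : realType) (f : R[i]^o -> R[i]^o) : Prop :=
  real_entire f /\
  exists Q : nat -> {poly R},
    (forall n, real_rooted (Q n)) /\
    forall K : set R[i]^o, compact K ->
      {uniform K, (fun n (z : R[i]^o) => (complex_poly (Q n)).[z] : R[i]^o)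
                    @ \oo --> f}.

Definition LPplus (R : realType) (f : R[i]^o -> R[i]^o) : Prop :=
  LP f /\ forall k : nat, 0 <= taylor_coef f k.

Definition power_series (R : realType) (c : nat -> R) (z : R[i]^o) :
    nat -> R[i]^o :=
  series (fun k : nat => (c k)%:C * z ^+ k : R[i]^o).

(* Extension of a coefficient sequence by zero to negative indices. *)
Definition coef_ext (R : realType) (a : nat -> R) (i : int) : R :=
  if i is Posz n then a n else 0.

Definition Lop (R : realType) (p : nat) (a : nat -> R) (k : nat) : R :=
  'C((2 * p).-1, p)%:R * a k ^+ 2 +
  \sum_(1 <= j < p.+1)
    (-1) ^+ j * 'C(2 * p, p - j)%:R
      * coef_ext a (k%:Z - j%:Z) * coef_ext a (k%:Z + j%:Z).

(* Main.v *)
Require Import Defs.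
From HB Require Import structures.
From mathcomp Require Import all_boot all_order all_algebra.
From mathcomp Require Import all_classical all_reals all_analysis.
From mathcomp Require Import complex.
From mathcomp Require Import cyclic separable cyclotomic ring lra zify.

(* A function of the class is approximated by its Jensen polynomials
   J_n(z) = sum_k a_k n!/(n-k)! (z/n)^k: they are reversals of phi(D) X^n, and
   phi(D) is a limit of products of operators D - x with x real, each of which
   preserves the absence of zeros in a half plane Im z > t (logarithmic
   derivative).  So J_n has only nonpositive zeros.

   For a polynomial q = prod_r (X - r) with all r <= 0 one substitutes z = w^2
   with Re w > 0.  Expanding (1 - X^2)^(2p) q(w X) X^N q(w / X) in two ways, with
   Von Szily's identity for the super Catalan numbers, turns sum_k L_k w^(2k)
   into a nonzero multiple of A(D) prod_r ((w^2 + r^2) + i r w X) at 0, where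
   A = sum_s (-1)^s X^(2s) / (s! (s+p)!).  These factors vanish at
   i (w/r + r/w) only, so all the zeros lie in a half plane Im < t0 < 0; A is a
   limit of real-rooted polynomials (Laguerre polynomials at -X^2/N), so the
   value at 0 is nonzero.  Hence sum_k L_k z^k vanishes only on the nonpositive
   half line. *)

Set Implicit Arguments.
Unset Strict Implicit.
Unset Printing Implicit Defensive.

Import Order.TTheory GRing.Theory Num.Theory.
Import numFieldNormedType.Exports.

Local Open Scope classical_set_scope.
Local Open Scope complex_scope.
Local Open Scope ring_scope.

(** * Differential operators and zero-free half planes *)

(** The polynomials given by the definition of the class cannot be fed to the operator directly:
    nonnegative coefficients are known for the limit only, so these polynomials may have positive
    zeros, while the root argument needs nonpositive ones. Jensen polynomials repair this. Their
    coefficients are [a k] times numbers in [0, 1], hence nonnegative, and their domination by [a k]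
    gives bounds uniform in n, hence uniform convergence on compact sets.

    Hurwitz's theorem is replaced by a growth bound: a polynomial of degree at most n without zeros
    in Im z > t is bounded at any w by a constant times its modulus at a fixed point of the half
    plane, the constant not depending on the polynomial. This is why every limit is taken with
    operators acting on one fixed polynomial.

    In the two expansions, each factor satisfies (w X - r)(w - r X) = (w^2 + r^2) X - r w (1 + X^2),
    so the product is a form in X and 1 + X^2, and the powers of 1 + X^2 meet (1 - X^2)^(2p) in Von
    Szily's sum. The bound t0 must be strictly negative because a limit stays zero free only on the
    open half plane Im z > t0, and this has to contain 0. *)

Section DiffOp.
Variable F : fieldType.
Implicit Types A g : {poly F}.

Definition dop A g : {poly F} := \sum_(i < size A) A`_i *: g^`(i).

Lemma dop_wide n A g : (size A <= n)%N -> dop A g = \sum_(i < n) A`_i *: g^`(i).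
Proof.
move=> leAn; rewrite /dop (big_ord_widen n (fun i => A`_i *: g^`(i))) // big_mkcond.
by apply: eq_bigr => i _; case: ltnP => // h; rewrite nth_default // scale0r.
Qed.

Lemma dopD A B g : dop (A + B) g = dop A g + dop B g.
Proof.
pose n := maxn (size (A + B)) (maxn (size A) (size B)).
rewrite !(@dop_wide n) ?leq_max ?leqnn ?orbT // -big_split.
by apply: eq_bigr => i _; rewrite coefD scalerDl.
Qed.

Lemma dopZ c A g : dop (c *: A) g = c *: dop A g.
Proof.
rewrite (@dop_wide (size A)) ?size_scale_leq // scaler_sumr.
by apply: eq_bigr => i _; rewrite coefZ scalerA.
Qed.

Lemma dop1 g : dop 1 g = g.
Proof. by rewrite /dop size_poly1 big_ord1 coef1 scale1r. Qed.

Lemma dopMX A g : dop (A * 'X) g = dop A g^`().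
Proof.
rewrite (@dop_wide (size A).+1) ?size_polyMleq //; last first.
  by rewrite (leq_trans (size_polyMleq _ _)) // size_polyX addn2.
rewrite big_ord_recl coefMX eqxx scale0r add0r.
by apply: eq_bigr => i _; rewrite lift0 coefMX derivSn.
Qed.

Lemma dopDr A f g : dop A (f + g) = dop A f + dop A g.
Proof.
by rewrite -big_split; apply: eq_bigr => i _; rewrite derivnD scalerDr.
Qed.

Lemma dopZr A c g : dop A (c *: g) = c *: dop A g.
Proof.
rewrite scaler_sumr; apply: eq_bigr => i _.
by rewrite derivnZ !scalerA mulrC.
Qed.

Lemma dopMXsubC A x g : dop (A * ('X - x%:P)) g = dop A (g^`() - x *: g).
Proof.
rewrite mulrBr dopD dopMX dopDr; congr (_ + _).
by rewrite mulrC mul_polyC -scaleNr dopZ -scaleNr dopZr.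
Qed.

Lemma dop_truncate n A g : (size g <= n)%N ->
  dop A g = \sum_(i < n) A`_i *: g^`(i).
Proof.
move=> leg; rewrite (@dop_wide (maxn n (size A))) ?leq_max ?leqnn ?orbT //.
rewrite [RHS](big_ord_widen (maxn n (size A)) (fun i => A`_i *: g^`(i))) ?leq_maxl //.
rewrite [RHS]big_mkcond; apply: eq_bigr => i _; case: ltnP => // h.
by rewrite derivn_poly0 ?scaler0 // (leq_trans leg).
Qed.

Lemma horner_dop0 n A g : (size g <= n)%N ->
  (dop A g).[0] = \sum_(i < n) A`_i * g`_i * i`!%:R.
Proof.
move=> leg; rewrite (dop_truncate A leg) horner_sum; apply: eq_bigr => i _.
rewrite hornerZ horner_coef0 coef_derivn addn0 ffactnn.
by rewrite -mulrA mulr_natr.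
Qed.

Lemma dop_neq0 A g : A`_0 != 0 -> g != 0 -> dop A g != 0.
Proof.
move=> A0 g0; have [n sg] : exists n, size g = n.+1.
  by exists (size g).-1; rewrite prednK // size_poly_gt0.
apply: contraNneq A0 => /(congr1 (fun p : {poly F} => p`_n)).
rewrite (@dop_truncate n.+1) ?sg // coef0 big_ord_recl coefD coefZ.
rewrite coef_sum big1 ?addr0 => [/eqP|i _].
  rewrite mulf_eq0 => /orP[//|/eqP gn0].
  by move: g0; rewrite -lead_coef_eq0 /lead_coef sg gn0 eqxx.
rewrite coefZ coef_derivn [X in X *+ _]nth_default ?mul0rn ?mulr0 //.
by rewrite sg lift0 addSn ltnS leq_addl.
Qed.

End DiffOp.

Section HalfPlane.
Variable C : numClosedFieldType.
Implicit Types (t x z : C) (A g h : {poly C}).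

(** For real [t] the zero polynomial is never [zfree], which is why later statements carry the
    alternative [g = 0]. The order is partial, so realness of [t] has to be assumed where heights
    are compared. *)
Definition zfree t g := forall z, t < 'Im z -> ~~ root g z.

Lemma zfreeC t c : c != 0 -> zfree t c%:P.
Proof. by move=> c0 z _; rewrite rootC. Qed.

Lemma zfreeM t g h : zfree t g -> zfree t h -> zfree t (g * h).
Proof. by move=> gP hP z tz; rewrite rootM negb_or gP ?hP. Qed.

Lemma zfree_factor t g : t \is Num.real -> g != 0 -> zfree t g ->
  exists2 rs : seq C, all (fun r => 'Im r <= t) rs &
    g = lead_coef g *: \prod_(r <- rs) ('X - r%:P).
Proof.
move=> tR g0 gP; have [rs gE] := closed_field_poly_normal g.
exists rs => //; apply/allP => r rrs.
rewrite real_leNgt ?Creal_Im //; apply/negP => /gP /negP; apply.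
by rewrite gE rootZ ?lead_coef_eq0 // root_prod_XsubC.
Qed.

Lemma Im_inv_lt0 z : 0 < 'Im z -> 'Im z^-1 < 0.
Proof.
move=> z0; rewrite ImV mulNr oppr_lt0 divr_gt0 // exprn_gt0 // normr_gt0.
by apply: contraTneq z0 => ->; rewrite raddf0 ltxx.
Qed.

(** Here [s] is the logarithmic derivative, the sum of the 1 / (z - r); each term has negative
    imaginary part because z lies above every root. Without roots the sum is 0, hence the separate
    case. *)
Lemma log_deriv t rs z : t < 'Im z -> all (fun r => 'Im r <= t) rs ->
  let g := \prod_(r <- rs) ('X - r%:P) in
  exists2 s, g^`().[z] = s * g.[z] & if rs is [::] then s = 0 else 'Im s < 0.
Proof.
move=> tz; elim: rs => [|r rs IH] /=.
  by exists 0 => //; rewrite big_nil derivC hornerC mul0r.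
case/andP=> rt /IH[s gE sP]; rewrite big_cons.
set g := \prod_(_ <- _) _ in gE *.
have rz : 0 < 'Im (z - r) by rewrite raddfB subr_gt0 (le_lt_trans rt).
have rz0 : z - r != 0 by apply: contraTneq rz => ->; rewrite raddf0 ltxx.
exists ((z - r)^-1 + s).
  rewrite derivM derivXsubC mul1r hornerD !hornerM hornerXsubC gE.
  by field.
rewrite raddfD /= -[ltRHS]addr0 ltr_leD ?Im_inv_lt0 //.
by case: rs sP {IH gE g} => [->|? ? /ltW //]; rewrite raddf0.
Qed.

(** At a point above all roots the value is (s - x) g(z), with s the logarithmic derivative. As Im s
    < 0 and x is real, s differs from x; only a constant [g] with x = 0 escapes, and then the result
    is 0. *)
Lemma zfree_deriv_sub t x g : t \is Num.real -> x \is Num.real ->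
  g != 0 -> zfree t g -> g^`() - x *: g = 0 \/ zfree t (g^`() - x *: g).
Proof.
move=> tR xR g0 gP; have [rs rst gE] := zfree_factor tR g0 gP.
have l0 : lead_coef g != 0 by rewrite lead_coef_eq0.
have [->|h0] := eqVneq (g^`() - x *: g) 0; [by left | right => z tz].
rewrite /root hornerD hornerN hornerZ.
have [s dE sP] := log_deriv tz rst.
have gz : g.[z] != 0 by apply: gP.
have -> : g^`().[z] = s * g.[z] by rewrite gE derivZ !hornerZ dE mulrCA.
rewrite -mulrBl mulf_neq0 // subr_eq0; apply: contraNneq h0 => sx.
case: rs sP {dE} rst gE => [s0 _ gE|r rs sI _ _].
  by rewrite -sx s0 scale0r subr0 gE big_nil alg_polyC derivC.
by move: sI; rewrite sx (Creal_ImP _ xR) ltxx.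
Qed.

(** [A] splits into factors X - x with x real, and the operators D - x are applied one at a time;
    any of them may already produce 0. *)
Lemma zfree_dop t A g : t \is Num.real -> A != 0 ->
  (forall z, root A z -> z \is Num.real) ->
  g = 0 \/ zfree t g -> dop A g = 0 \/ zfree t (dop A g).
Proof.
move=> tR A0 AP; have [rs AE] := closed_field_poly_normal A.
have lA : lead_coef A != 0 by rewrite lead_coef_eq0.
have {AP} rsR : all (fun r => r \is Num.real) rs.
  by apply/allP => r rrs; apply: AP; rewrite AE rootZ // root_prod_XsubC.
rewrite {}AE dopZ => gP.
suff: dop (\prod_(z <- rs) ('X - z%:P)) g = 0 \/
      zfree t (dop (\prod_(z <- rs) ('X - z%:P)) g).
  case=> [->|h]; [by left; rewrite scaler0|right].
  by rewrite -mul_polyC; apply: zfreeM => //; apply: zfreeC.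
elim: rs rsR g gP => [|r rs IH] /= => [_ g gP|/andP[rR rsR] g gP].
  by rewrite big_nil dop1.
rewrite big_cons mulrC dopMXsubC; apply: IH => //.
have [->|g0] := eqVneq g 0; first by left; rewrite linear0 scaler0 subrr.
case: gP => [gE|]; first by rewrite gE eqxx in g0.
exact: zfree_deriv_sub.
Qed.

(** Quantitative substitute for Hurwitz's theorem: the constant depends on [g] only through the
    degree bound, so smallness at [z0] forces smallness everywhere. *)
Lemma zfree_growth t n g z0 w : t \is Num.real -> zfree t g ->
  (size g <= n.+1)%N -> t < 'Im z0 ->
  `|g.[w]| <= (1 + `|w - z0| / ('Im z0 - t)) ^+ n * `|g.[z0]|.
Proof.
move=> tR gP gn tz.
have dz : 0 < 'Im z0 - t by rewrite subr_gt0.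
set k := 1 + _.
have k1 : 1 <= k by rewrite lerDl divr_ge0 // ltW.
have [->|g0] := eqVneq g 0; first by rewrite !horner0 normr0 mulr0.
have [rs rst gE] := zfree_factor tR g0 gP.
have srs : (size rs <= n)%N.
  by move: gn; rewrite gE size_scale ?lead_coef_eq0 // size_prod_XsubC.
rewrite gE !hornerZ !normrM mulrCA ler_wpM2l //.
rewrite !horner_prod !normr_prod.
(* There may be fewer than [n] roots; as [k >= 1], the exponent can be raised to [n]. *)
apply: (@le_trans _ _ (k ^+ size rs * \prod_(r <- rs) `|('X - r%:P).[z0]|)); last first.
  rewrite ler_wpM2r ?prodr_ge0 // ler_weXn2l //.
have -> : k ^+ size rs = \prod_(r <- rs) k by rewrite big_const_seq count_predT iter_mulr_1.
rewrite -big_split /=.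
rewrite ![\prod_(_ <- rs) _]big_seq; apply: ler_prod => r rrs; rewrite normr_ge0 /=.
rewrite !hornerXsubC.
(* All roots have height at most [t], so the distance to [z0] is bounded below; this makes |w - z0|
   + |z0 - r| a bounded multiple of |z0 - r|. *)
have zr : 'Im z0 - t <= `|z0 - r|.
  have : 'Im (z0 - r) <= `|z0 - r|.
    have := leif_Re_Creal (- 'i * (z0 - r)).
    by rewrite mulNr raddfN /= ReMil opprK normrN normrM normCi mul1r => - [].
  by apply: le_trans; rewrite raddfB lerD2l lerN2 (allP rst).
have -> : w - r = (w - z0) + (z0 - r) by ring.
apply: le_trans (ler_normD _ _) _.
rewrite /k mulrDl mul1r addrC lerD2l -mulrA ler_peMr //.
by rewrite mulrC ler_pdivlMr // mul1r.
Qed.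

End HalfPlane.

(** * Laguerre polynomials and Von Szily's identity *)

Lemma natfact_neq0 (F : numDomainType) n : n`!%:R != 0 :> F.
Proof. by rewrite pnatr_eq0 -lt0n fact_gt0. Qed.

Section Laguerre.
Variable C : numClosedFieldType.
Implicit Types (z : C) (g : {poly C}).

Lemma root_conj g z : g \is a polyOver Num.real -> root g z -> root g z^*%R.
Proof.
move=> gR gz; have gJ : map_poly Num.conj g = g.
  apply/polyP => i; rewrite coef_map /=; apply: conj_Creal.
  by move/polyOverP: gR; apply.
by rewrite -gJ /root horner_map /= (rootP gz) rmorph0.
Qed.

Lemma zfree_real g z : g \is a polyOver Num.real -> zfree 0 g ->
  root g z -> z \is Num.real.
Proof.
move=> gR gP gz; have gzJ := root_conj gR gz.
apply/Creal_ImP/eqP; have /orP[] := real_leVge (Creal_Im z) (real0 C).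
  rewrite le_eqVlt => /orP[//|z0]; have := gP z^*%R.
  by rewrite Im_conj oppr_gt0 gzJ => /(_ z0).
rewrite le_eqVlt eq_sym => /orP[//|/gP]; by rewrite gz.
Qed.

(** Up to the factor N! / (N + p)!, the generalized Laguerre polynomial of degree N and parameter p
    at -X. *)
Definition lag p N : {poly C} := \poly_(s < N.+1) ('C(N, s)%:R / (s + p)`!%:R).

(* Rodrigues' formula for the Laguerre polynomials. *)
Lemma dop_lag p N :
  dop (('X + 1) ^+ N) 'X^(N + p) = (N + p)`!%:R *: ('X^p * lag p N).
Proof.
have coefX1 i : (('X + 1) ^+ N : {poly C})`_i = 'C(N, i)%:R.
  rewrite addrC exprDn coef_sum.
  under eq_bigr do rewrite expr1n mul1r coefMn coefXn.
  have [iN|iN] := ltnP i N.+1; last first.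
    rewrite big1 ?bin_small // => j _.
    by rewrite (gtn_eqF (leq_trans (ltn_ord j) iN)) mul0rn.
  rewrite (bigD1 (Ordinal iN)) //= eqxx big1 ?addr0 // => j.
  by rewrite -val_eqE /= eq_sym => /negPf ->; rewrite mul0rn.
rewrite (@dop_wide _ N.+1); last first.
  by rewrite (leq_trans (size_poly_exp_leq _ _)) // -polyC1 size_XaddC mul1n.
rewrite (reindex_inj rev_ord_inj) /= /lag poly_def mulr_sumr scaler_sumr.
apply: eq_bigr => s _; rewrite coefX1 subSS derivnXn.
have sN : (s <= N)%N by rewrite -ltnS.
have -> : (N + p - (N - s) = p + s)%N by lia.
have fE : ((N + p) ^_ (N - s))%:R = (N + p)`!%:R / (s + p)`!%:R :> C.
  apply: (canRL (mulfK (natfact_neq0 _ _))); rewrite -natrM; congr (_%:R).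
  have -> : (s + p = (N + p) - (N - s))%N by lia.
  by rewrite ffact_fact // leq_subLR; lia.
rewrite bin_sub // -['X^_ *+ _]mulr_natl -polyC_natr fE -!mul_polyC !polyCM exprD.
ring.
Qed.

(** The only root of (X + 1)^N is real, so the operator in Rodrigues' formula keeps the upper half
    plane zero free; being real, the polynomial then has only real roots. Its coefficients are
    nonnegative and its constant term is positive, which excludes positive roots. *)
Lemma lag_root p N z : root (lag p N) z -> z <= 0.
Proof.
move=> zr.
have lagR : lag p N \is a polyOver Num.real.
  apply/polyOverP => i; rewrite coef_poly; case: ifP => _; last exact: rpred0.
  by rewrite rpredM ?rpredV ?realn.
have zR : z \is Num.real.
  apply: (zfree_real lagR) zr => y y0.
  have X10 : ('X + 1) ^+ N != 0 :> {poly C}.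
    by rewrite expf_neq0 // -polyC1 -size_poly_eq0 size_XaddC.
  have X1R (u : C) : root (('X + 1) ^+ N) u -> u \is Num.real.
    rewrite /root horner_exp expf_eq0 => /andP[_].
    by rewrite hornerD hornerX hornerC addr_eq0 => /eqP->; rewrite rpredN real1.
  have Xfree : 'X^(N + p) = 0 :> {poly C} \/ zfree 0 ('X^(N + p) : {poly C}).
    right=> u u0; rewrite /root hornerXn expf_neq0 //.
    by apply: contraTneq u0 => ->; rewrite raddf0 ltxx.
  case: (zfree_dop (real0 C) X10 X1R Xfree) => [/eqP|/(_ y y0)]; last first.
    by rewrite dop_lag rootZ ?natfact_neq0 // rootM negb_or => /andP[].
  rewrite (negPf (dop_neq0 _ _)) ?expf_neq0 ?polyX_eq0 //.
  by rewrite -horner_coef0 horner_exp hornerD hornerX hornerC add0r expr1n oner_neq0.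
rewrite real_leNgt ?real0 //; apply/negP => z0.
have : 0 < (lag p N).[z].
  rewrite /lag horner_poly big_ord_recl /= bin0 mul1r expr0 mulr1 add0n.
  rewrite ltr_pwDl ?invr_gt0 ?ltr0n ?fact_gt0 //.
  by rewrite sumr_ge0 // => i _; rewrite mulr_ge0 ?exprn_ge0 ?(ltW z0) // divr_ge0.
by rewrite (rootP zr) ltxx.
Qed.

(* For c s = 1 / s! this is a truncation of the entire function
   sum_s (-1)^s X^(2 s) / (s! (s + p)!), a limit of the real-rooted polynomials
   with c s = 'C(N, s) / N^s, which are lag p N at - X^2 / N. *)
Definition bessel_poly p (c : nat -> C) n : {poly C} :=
  \poly_(i < n.+1) (if odd i then 0 else (- 1) ^+ i./2 * c i./2 / (i./2 + p)`!%:R).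

Definition binom_ratio N s : C := 'C(N, s)%:R / N%:R ^+ s.

Lemma bessel_poly_binom p N :
  bessel_poly p (binom_ratio N) N.*2 = lag p N \Po (- N%:R^-1 *: 'X^2).
Proof.
have -> : - N%:R^-1 *: 'X^2 = (- N%:R^-1 *: 'X) \Po 'X^2 :> {poly C}.
  by rewrite comp_polyZ comp_polyX.
rewrite comp_polyA; apply/polyP => i; rewrite coef_comp_poly_Xn // dvdn2.
rewrite coef_poly; case: (boolP (odd i)) => [_|/= iE]; first by rewrite if_same.
have -> : (i %/ 2 = i./2)%N by rewrite divn2.
rewrite coef_comp_poly.
have li : (i < N.*2.+1)%N = (i./2 < N.+1)%N by lia.
rewrite li; case: ltnP => iN; last first.
  rewrite big1 // => j _; rewrite exprZn coefZ coefXn [X in _ * (_ * X)](_ : _ = 0) ?mulr0 //.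
  suff /gtn_eqF-> : (j < i./2)%N by [].
  by apply: leq_trans (ltn_ord j) (leq_trans (size_poly _ _) iN).
have [is_|is_] := ltnP i./2 (size (lag p N)); last first.
  move: (nth_default 0 is_); rewrite coef_poly iN => /eqP.
  by rewrite mulf_eq0 invr_eq0 (negPf (natfact_neq0 _ _)) orbF pnatr_eq0 -leqn0 leqNgt bin_gt0 -ltnS iN.
rewrite (bigD1 (Ordinal is_)) //= big1 ?addr0 => [|j].
  rewrite coef_poly iN exprZn coefZ coefXn eqxx mulr1 -[- N%:R^-1]mulN1r exprMn exprVn /binom_ratio.
  ring.
rewrite -val_eqE /= exprZn coefZ coefXn eq_sym => /negPf->.
by rewrite !mulr0.
Qed.

Lemma bessel_poly_binom_root p N z : (0 < N)%N ->
  root (bessel_poly p (binom_ratio N) N.*2) z -> z \is Num.real.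
Proof.
move=> N0; rewrite bessel_poly_binom root_comp => /lag_root.
rewrite hornerZ hornerXn mulNr oppr_le0 pmulr_rge0 ?invr_gt0 ?ltr0n //.
by rewrite realEsqr.
Qed.

End Laguerre.

Section VonSzily.
Variable F : numFieldType.

Definition super_catalan p s : F :=
  (p.*2)`!%:R * (s.*2)`!%:R / (p`!%:R * s`!%:R * (p + s)`!%:R).

Lemma super_catalan_rec p s :
  super_catalan p.+1 s + super_catalan p s.+1 = 4%:R * super_catalan p s.
Proof.
rewrite /super_catalan addSn addnS !doubleS !factS !natrM.
have := natfact_neq0 F p; have := natfact_neq0 F s; have := natfact_neq0 F (p + s).
have e1 : (p + s).+1%:R = p%:R + s%:R + 1 :> F by rewrite -addn1 !natrD.
have e2 : (p.*2).+2%:R = 2 * (p%:R + 1) :> F.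
  by rewrite -doubleS -mul2n natrM -[p.+1%:R]natr1.
have e3 : (s.*2).+2%:R = 2 * (s%:R + 1) :> F.
  by rewrite -doubleS -mul2n natrM -[s.+1%:R]natr1.
have e4 : (p.*2).+1%:R = 2 * p%:R + 1 :> F by rewrite -addn1 natrD -mul2n natrM.
have e5 : (s.*2).+1%:R = 2 * s%:R + 1 :> F by rewrite -addn1 natrD -mul2n natrM.
rewrite e1 e2 e3 e4 e5 -[p.+1%:R]natr1 -[s.+1%:R]natr1.
have : p%:R + s%:R + 1 != 0 :> F by rewrite -e1 pnatr_eq0.
have : p%:R + 1 != 0 :> F by rewrite natr1 pnatr_eq0.
have : s%:R + 1 != 0 :> F by rewrite natr1 pnatr_eq0.
move=> h1 h2 h3 h4 h5 h6; field; by rewrite h1 h2 h3 h4 h5 h6.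
Qed.

(* Induction on p, from (1 + X)^2 - (1 - X)^2 = 4 X. *)
Lemma coef_von_szily p s :
  ((1 - 'X) ^+ p.*2 * (1 + 'X) ^+ s.*2 : {poly F})`_(p + s) =
  (- 1) ^+ p * super_catalan p s.
Proof.
elim: p s => [|p IH] s.
  rewrite double0 !expr0 !mul1r exprDn coef_sum add0n.
  have s2 : (s < s.*2.+1)%N by lia.
  rewrite (bigD1 (Ordinal s2)) //= big1 => [|j]; last first.
    by rewrite -val_eqE expr1n mul1r coefMn coefXn /= eq_sym => /negPf->; rewrite mul0rn.
  rewrite expr1n mul1r coefMn coefXn eqxx addr0 /super_catalan double0 fact0 add0n !mul1r.
  apply: (canRL (mulfK _)); first by rewrite mulf_neq0 ?natfact_neq0.
  rewrite -!natrM; congr (_%:R).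
  have ss : (s <= s.*2)%N by rewrite -addnn leq_addl.
  have sB : (s.*2 - s = s)%N by rewrite -addnn addnK.
  by move: (bin_fact ss); rewrite sB.
have : ((1 - 'X) ^+ p.+1.*2 * (1 + 'X) ^+ s.*2 : {poly F})
     = (1 - 'X) ^+ p.*2 * (1 + 'X) ^+ s.+1.*2
       - 4%:R *: ((1 - 'X) ^+ p.*2 * (1 + 'X) ^+ s.*2 * 'X).
  have eS q : (q.+1.*2 = q.*2 + 2)%N by rewrite doubleS addn2.
  rewrite !eS !exprD -mul_polyC polyC_natr; move: (_ ^+ p.*2) (_ ^+ s.*2) => u v; ring.
move=> ->; rewrite coefB coefZ addSn coefMX /= -addnS !IH exprS.
have -> : super_catalan p.+1 s = 4%:R * super_catalan p s - super_catalan p s.+1.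
  by rewrite -super_catalan_rec addrK.
ring.
Qed.

(** The identity with X^2 in place of X: an odd [m] asks for a coefficient of odd degree of an even
    polynomial. *)
Lemma coef_sqr_von_szily p m :
  ((1 - 'X^2) ^+ p.*2 * (1 + 'X^2) ^+ m : {poly F})`_(m + p.*2) =
  if odd m then 0 else (- 1) ^+ p * super_catalan p m./2.
Proof.
have -> : (1 - 'X^2) ^+ p.*2 * (1 + 'X^2) ^+ m =
    ((1 - 'X) ^+ p.*2 * (1 + 'X) ^+ m) \Po 'X^2 :> {poly F}.
  rewrite rmorphM !rmorphXn /= rmorphB rmorphD /= comp_polyX.
  by rewrite -polyC1 comp_polyC.
rewrite coef_comp_poly_Xn // dvdn2 oddD odd_double addbF.
case: (boolP (odd m)) => //= mE; rewrite -coef_von_szily.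
have {1 2}-> : m = m./2.*2 by lia.
congr (_`_ _); rewrite divn2; lia.
Qed.

End VonSzily.

(** * The diagonal identity *)

Section Homogenization.
Variable F : fieldType.
Implicit Types (E x y : {poly F}).

(** Homogenization: y^N E(x / y), written without division. *)
Definition hom N E x y : {poly F} := \sum_(m < N.+1) E`_m *: (x ^+ m * y ^+ (N - m)).

Lemma homD N E E' x y : hom N (E + E') x y = hom N E x y + hom N E' x y.
Proof. by rewrite -big_split; apply: eq_bigr => i _; rewrite coefD scalerDl. Qed.

Lemma homZ N c E x y : hom N (c *: E) x y = c *: hom N E x y.
Proof. by rewrite scaler_sumr; apply: eq_bigr => i _; rewrite coefZ scalerA. Qed.

Lemma homS N E x y : (size E <= N.+1)%N -> hom N.+1 E x y = y * hom N E x y.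
Proof.
move=> sE; rewrite /hom big_ord_recr /= nth_default // scale0r addr0 mulr_sumr.
apply: eq_bigr => i _; have iN : (i <= N)%N by rewrite -ltnS.
by rewrite subSn // exprS -scalerAr mulrCA.
Qed.

Lemma homMX N E x y : hom N.+1 (E * 'X) x y = x * hom N E x y.
Proof.
rewrite /hom big_ord_recl coefMX eqxx scale0r add0r mulr_sumr.
apply: eq_bigr => i _; rewrite lift0 coefMX /= subSS exprS -scalerAr.
by rewrite mulrA.
Qed.

Lemma size_prod_affine (I : Type) (r : seq I) (al be : I -> F) :
  (size (\prod_(i <- r) ((al i)%:P + be i *: 'X))%R <= (size r).+1)%N.
Proof.
elim: r => [|i r IH]; first by rewrite big_nil size_poly1.
rewrite big_cons; apply: leq_trans (size_polyMleq _ _) _.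
have h : (size ((al i)%:P + be i *: 'X)%R <= 2)%N.
  rewrite (leq_trans (size_polyD _ _)) // geq_max (leq_trans (size_polyC_leq1 _)) //.
  by rewrite (leq_trans (size_scale_leq _ _)) ?size_polyX.
by have := leq_add h IH; rewrite /= -subn1 leq_subLR add1n.
Qed.

(** The degree of homogenization counts factors, not the true degree: a factor with [be i = 0] still
    contributes one power of [y]. Roots r = 0 produce such factors later. *)
Lemma hom_prod (I : Type) (r : seq I) (al be : I -> F) x y :
  hom (size r) (\prod_(i <- r) ((al i)%:P + be i *: 'X)) x y =
  \prod_(i <- r) (al i *: y + be i *: x).
Proof.
elim: r => [|i r IH] /=.
  by rewrite !big_nil /hom big_ord1 coef1 scale1r !expr0 mulr1.
rewrite !big_cons mulrDl homD mul_polyC homZ -scalerAl homZ mulrC homMX.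
rewrite homS ?IH; last first.
  exact: size_prod_affine.
by rewrite mulrDl !scalerAl.
Qed.

End Homogenization.

Section Diagonal.
Variable R : comNzRingType.

(** The operator of the theorem over any commutative ring, so that it applies to complex
    coefficients; the guard [j <= k] stands for the extension by zero to negative indices. *)
Definition lopn (p : nat) (a : nat -> R) (k : nat) : R :=
  'C((2 * p).-1, p)%:R * a k ^+ 2 +
  \sum_(1 <= j < p.+1)
    (-1) ^+ j * 'C(2 * p, p - j)%:R
      * (if (j <= k)%N then a (k - j)%N else 0) * a (k + j)%N.

(** Regrouping along i + j = l: odd antidiagonals vanish, and the indices beyond [N] that the
    right-hand side admits contribute zero. *)
Lemma sum_antidiag N (G : nat -> nat -> R) :
  (forall i j, odd (i + j) -> G i j = 0) ->
  (forall i j, (N < i)%N || (N < j)%N -> G i j = 0) ->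
  \sum_(i < N.+1) \sum_(j < N.+1) G i j =
  \sum_(k < N.+1) \sum_(i < k.*2.+1) G i (k.*2 - i)%N.
Proof.
move=> Godd Gbig.
have step1 (i : nat) : (i <= N)%N -> \sum_(j < N.+1) G i j =
    \sum_(l < N.*2.+1 | (i <= l)%N) G i (l - i)%N.
  move=> iN.
  rewrite (big_ord_widen (N.*2.+1 - i) (G i)); last by lia.
  rewrite [LHS](_ : _ = \sum_(j < N.*2.+1 - i) G i j); last first.
    rewrite big_mkcond; apply: eq_bigr => j _; case: ltnP => // ?.
    by rewrite Gbig // orbC; apply/orP; left.
  rewrite -(big_mkord xpredT (G i)).
  rewrite -(big_mkord (fun l => (i <= l)%N) (fun l => G i (l - i)%N)).
  rewrite [RHS](@big_cat_nat _ _ _ i) //=; last by lia.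
  have -> : \sum_(0 <= l < i | (i <= l)%N) G i (l - i)%N = 0.
    by rewrite big_nat_cond big1 // => l h; exfalso; lia.
  rewrite add0r.
  have := big_addn 0 N.*2.+1 i (fun l => i <= l)%N (fun l => G i (l - i)%N).
  rewrite add0n => ->.
  by apply: eq_big => l; [rewrite leq_addl | rewrite addnK].
under eq_bigr => i _ do rewrite (step1 _ (ltnSE (ltn_ord i))).
rewrite (exchange_big_dep xpredT) //=.
have step2 (l : nat) : \sum_(i < N.+1 | (i <= l)%N) G i (l - i)%N =
    \sum_(i < l.+1) G i (l - i)%N.
  rewrite (big_ord_widen (N + l).+1 (fun i => G i (l - i)%N)) ?ltnS ?leq_addl //.
  rewrite (big_ord_widen_cond (N + l).+1 (fun i => i <= l)%N (fun i => G i (l - i)%N)) ?ltnS ?leq_addr //.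
  rewrite [LHS]big_mkcond [RHS]big_mkcond; apply: eq_bigr => i _ /=; rewrite !ltnS.
  case: (leqP i l) => //= il. case: leqP => // h. by rewrite Gbig ?h.
under eq_bigr do rewrite step2.
pose T l := \sum_(i < l.+1) G i (l - i)%N.
suff H M : \sum_(l < M.*2.+1) T l = \sum_(k < M.+1) T k.*2 by exact: H.
elim: M => [|M IH]; first by rewrite !big_ord1.
rewrite doubleS big_ord_recr big_ord_recr /= IH [RHS]big_ord_recr /= doubleS -addrA.
congr (_ + _); rewrite {1}/T big1 ?add0r // => i _.
have := ltn_ord i; rewrite ltnS => ?.
by rewrite Godd // subnKC //= odd_double.
Qed.

Lemma sum_sym_antidiag k (G : nat -> nat -> R) : (forall i j, G i j = G j i) ->
  \sum_(i < k.*2.+1) G i (k.*2 - i)%N =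
  G k k + 2 * \sum_(1 <= d < k.+1) G (k - d)%N (k + d)%N.
Proof.
move=> Gsym; rewrite -(big_mkord xpredT (fun i => G i (k.*2 - i)%N)).
rewrite (@big_cat_nat _ _ _ k) //=; last by lia.
rewrite [X in _ + X]big_ltn; last by lia.
have -> : (k.*2 - k = k)%N by lia.
have -> : \sum_(0 <= i < k) G i (k.*2 - i)%N = \sum_(1 <= d < k.+1) G (k - d)%N (k + d)%N.
  rewrite big_nat_rev big_add1 /= big_nat [RHS]big_nat; apply: eq_bigr => i ik.
  by rewrite add0n; congr (G _ _); lia.
have -> : \sum_(k.+1 <= i < k.*2.+1) G i (k.*2 - i)%N =
    \sum_(1 <= d < k.+1) G (k - d)%N (k + d)%N.
  rewrite -[k.+1]add1n big_addn.
  have -> : (k.*2.+1 - k = k.+1)%N by lia.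
  rewrite big_nat [RHS]big_nat; apply: eq_bigr => i ik.
  by rewrite Gsym; congr (G _ _); lia.
by rewrite addrCA; ring.
Qed.

End Diagonal.

(** This accounts for the coefficient 'C(2p - 1, p) in the operator: the diagonal term occurs once
    and each off-diagonal pair twice, so a common factor 2 comes out. *)
Lemma bin_center p : (0 < p)%N -> 'C(p.*2, p) = (2 * 'C((2 * p).-1, p))%N.
Proof.
case: p => // p _.
have -> : (p.+1.*2 = (p.*2.+1).+1)%N by rewrite doubleS.
have -> : ((2 * p.+1).-1 = p.*2.+1)%N by lia.
rewrite binS mulSn mul1n; congr (_ + _)%N.
by rewrite -bin_sub; [congr 'C(_, _); lia | lia].
Qed.

Section DiagonalIdentity.
Variable C : numClosedFieldType.
Implicit Types (w : C) (q : {poly C}).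

Lemma coef_sqr_binomial p n :
  ((1 - 'X^2) ^+ p : {poly C})`_n =
  if odd n then 0 else (- 1) ^+ n./2 * 'C(p, n./2)%:R.
Proof.
have -> : (1 - 'X^2) ^+ p = (1 - 'X) ^+ p \Po 'X^2 :> {poly C}.
  by rewrite rmorphXn /= rmorphB /= comp_polyX -polyC1 comp_polyC.
rewrite coef_comp_poly_Xn // dvdn2; case: (odd n) => //=.
rewrite divn2; move: n./2 => {}n.
rewrite -['X]scale1r -scaleNr exprDn coef_sum.
under eq_bigr => i _ do rewrite expr1n mul1r coefMn exprZn coefZ coefXn.
have [np|np] := ltnP n p.+1; last first.
  rewrite bin_small // mulr0 big1 // => j _.
  by rewrite (gtn_eqF (leq_trans (ltn_ord j) np)) mulr0 mul0rn.
rewrite (bigD1 (Ordinal np)) //= big1 ?addr0 => [|j].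
  by rewrite eqxx mulr1 mulr_natr.
by rewrite -val_eqE /= eq_sym => /negPf->; rewrite mulr0 mul0rn.
Qed.

(** With truncated subtraction [i - j + (j - i)] is |i - j|, so the sign and the binomial are those
    at distance |i - j| / 2 from the centre of (1 - X^2)^(2p). *)
Definition diag_kernel p i j : C :=
  if odd (i + j) then 0
  else (- 1) ^+ (p + (i - j + (j - i))./2) * 'C(p.*2, p + (i - j + (j - i))./2)%:R.

Lemma diag_kernel_sym p i j : diag_kernel p i j = diag_kernel p j i.
Proof. by rewrite /diag_kernel [(i + j)%N]addnC [(i - j + _)%N]addnC. Qed.

Lemma coef_diag_kernel p N i j : (i <= N)%N -> (j <= N)%N ->
  ((1 - 'X^2) ^+ p.*2 * 'X^(i + (N - j)) : {poly C})`_(N + p.*2) = diag_kernel p i j.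
Proof.
move=> iN jN; rewrite coefMXn coef_sqr_binomial /diag_kernel.
(* In the first case i - j exceeds 2p, and the binomial of the kernel vanishes as well. *)
have [big|small] := ltnP.
  case: ifP => // oij; rewrite bin_small ?mulr0 //; lia.
have -> : odd (N + p.*2 - (i + (N - j))) = odd (i + j) by lia.
case: ifP => // oij; have [ij|ji] := leqP i j.
  have -> : ((N + p.*2 - (i + (N - j)))./2 = p + (i - j + (j - i))./2)%N by lia.
  by [].
have -> : ((N + p.*2 - (i + (N - j)))./2 = p - (i - j + (j - i))./2)%N by lia.
have le : ((i - j + (j - i))./2 <= p)%N by lia.
move: _./2 le => d le; rewrite -bin_sub; last by lia.
have -> : (p.*2 - (p - d) = p + d)%N by lia.
by congr (_ * _); rewrite -signr_odd -[RHS]signr_odd oddB // oddD.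
Qed.

(** On the antidiagonal i + j = 2k the pair (k - d, k + d) has weight (-1)^(p + d) 'C(2p, p + d) and
    occurs twice for d > 0, which yields twice the operator up to the sign (-1)^p. *)
Lemma sum_diag_kernel p N q w : (0 < p)%N -> (size q <= N.+1)%N ->
  \sum_(i < N.+1) \sum_(j < N.+1) q`_i * q`_j * w ^+ (i + j) * diag_kernel p i j =
  (- 1) ^+ p * 2 * \sum_(k < N.+1) lopn p (nth 0 q) k * w ^+ k.*2.
Proof.
move=> p0 sq; pose G i j := q`_i * q`_j * w ^+ (i + j) * diag_kernel p i j.
rewrite (@sum_antidiag _ N G); first last.
- move=> i j /orP[] /(leq_trans sq) h; rewrite /G.
    by rewrite [q`_i]nth_default // !mul0r.
  by rewrite [q`_j]nth_default // mulr0 !mul0r.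
- by move=> i j h; rewrite /G /diag_kernel h mulr0.
rewrite mulr_sumr; apply: eq_bigr => k _.
rewrite sum_sym_antidiag; last first.
  by move=> i j; rewrite /G diag_kernel_sym addnC [q`_i * _]mulrC.
pose g d := (- 1) ^+ d * 'C(2 * p, p - d)%:R *
  (if (d <= k)%N then q`_(k - d) else 0) * q`_(k + d).
(* For d > p the truncated [p - d] would give the binomial 1; with [p + d] it is 0, so the sums up
   to [p] and up to [k] can both be extended to [k + p] and compared. *)
pose g' d := (- 1) ^+ d * 'C(2 * p, p + d)%:R *
  (if (d <= k)%N then q`_(k - d) else 0) * q`_(k + d).
have cut m n (h : nat -> C) : (m <= n)%N -> (forall d, (m < d)%N -> h d = 0) ->
    \sum_(1 <= d < n.+1) h d = \sum_(1 <= d < m.+1) h d.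
  move=> mn h0; rewrite (@big_cat_nat _ _ _ m.+1) //= [X in _ + X]big_nat.
  by rewrite [X in _ + X]big1 ?addr0 // => d /andP[md _]; rewrite h0.
have gg' : \sum_(1 <= d < p.+1) g d = \sum_(1 <= d < k.+1) g' d.
  rewrite -(@cut k (k + p)%N g') ?leq_addr //; last first.
    by move=> d kd; rewrite /g' leqNgt kd mulr0 mul0r.
  rewrite (@cut p (k + p)%N g') ?leq_addl //; last first.
    by move=> d pd; rewrite /g' bin_small ?mulr0 ?mul0r //; lia.
  rewrite big_nat [RHS]big_nat; apply: eq_bigr => d dp; rewrite /g /g'.
  have -> : 'C(2 * p, p - d) = 'C(2 * p, p + d); last by [].
  by rewrite -bin_sub; [congr 'C(_, _); lia | lia].
have -> : \sum_(1 <= d < k.+1) G (k - d)%N (k + d)%N =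
   (- 1) ^+ p * w ^+ k.*2 * \sum_(1 <= d < k.+1) g' d.
  rewrite mulr_sumr big_nat [RHS]big_nat; apply: eq_bigr => d /andP[_ dk].
  rewrite ltnS in dk; rewrite /G /g' dk.
  have -> : (k - d + (k + d) = k.*2)%N by lia.
  rewrite /diag_kernel.
  have -> : (k - d + (k + d) = k.*2)%N by lia.
  have -> : ((k - d - (k + d) + (k + d - (k - d)))./2 = d)%N by lia.
  rewrite odd_double exprD mul2n; ring.
rewrite -gg' /lopn -/(g _) /G addnn /diag_kernel addnn odd_double subnn addn0 /= !addn0.
rewrite bin_center // natrM; ring.
Qed.

(** The two homogenizations are q(w X) and X^N q(w / X), so the pair (i, j) contributes the power i
    + (N - j) of X; the extracted coefficient is then the kernel. *)
Lemma hom_diag p N q w : (0 < p)%N -> (size q <= N.+1)%N ->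
  ((1 - 'X^2) ^+ p.*2 * (hom N q (w *: 'X) 1 * hom N q w%:P 'X))`_(N + p.*2) =
  (- 1) ^+ p * 2 * \sum_(k < N.+1) lopn p (nth 0 q) k * w ^+ k.*2.
Proof.
move=> p0 sq; rewrite -sum_diag_kernel // mulr_suml mulr_sumr coef_sum.
apply: eq_bigr => i _; rewrite mulr_sumr mulr_sumr coef_sum.
apply: eq_bigr => j _.
have iN : (i <= N)%N by rewrite -ltnS.
have jN : (j <= N)%N by rewrite -ltnS.
rewrite -(coef_diag_kernel p iN jN) expr1n mulr1 exprZn -polyC_exp mul_polyC.
rewrite -coefZ -!mul_polyC !polyCM !exprD polyCM; congr ((polyseq _)`_ _); ring.
Qed.

Lemma hom_von_szily p N (E : {poly C}) :
  ((1 - 'X^2) ^+ p.*2 * hom N E (1 + 'X^2) 'X)`_(N + p.*2) =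
  (- 1) ^+ p * \sum_(m < N.+1)
     (if odd m then 0 else E`_m * super_catalan C p m./2).
Proof.
rewrite mulr_sumr coef_sum mulr_sumr; apply: eq_bigr => m _.
have mN : (m <= N)%N by rewrite -ltnS.
rewrite -scalerAr coefZ mulrA coefMXn.
have -> : (N + p.*2 < N - m)%N = false by lia.
have -> : (N + p.*2 - (N - m) = m + p.*2)%N by lia.
rewrite coef_sqr_von_szily; case: ifP => _; rewrite ?mulr0 //; ring.
Qed.

(** The derivative of order 2s at 0 supplies (2s)! E_(2s), and the sign (-i)^(2s) = (-1)^s cancels
    the one in the Bessel coefficients; (2p)! / p! is the part of the super Catalan number
    independent of s. The rotation by -i turns a left half plane of zeros into a lower one. *)
Lemma dop_von_szily p N (E : {poly C}) : (size E <= N.+1)%N ->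
  (p.*2)`!%:R / p`!%:R *
  (dop (bessel_poly p (fun s => (s`!%:R)^-1) N) (E \Po (- 'i *: 'X))).[0] =
  \sum_(m < N.+1) (if odd m then 0 else E`_m * super_catalan C p m./2).
Proof.
move=> sE; rewrite (@horner_dop0 _ N.+1); last first.
  rewrite (leq_trans (size_comp_poly_leq _ _)) // size_scale ?oppr_eq0 ?neq0Ci //.
  by rewrite size_polyX muln1; case: (size E) sE.
rewrite mulr_sumr; apply: eq_bigr => m _.
have -> : (E \Po (- 'i *: 'X))`_m = E`_m * (- 'i) ^+ m.
  rewrite comp_polyE coef_sum.
  have [mE|mE] := ltnP m (size E); last first.
    rewrite nth_default // mul0r big1 // => j _.
    by rewrite exprZn !coefZ coefXn gtn_eqF ?mulr0 // (leq_trans (ltn_ord j)).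
  rewrite (bigD1 (Ordinal mE)) //= big1 ?addr0 => [|j].
    by rewrite exprZn !coefZ coefXn eqxx mulr1.
  by rewrite -val_eqE /= exprZn !coefZ coefXn eq_sym => /negPf->; rewrite !mulr0.
rewrite coef_poly ltn_ord; case: ifP => [_|/negbT mE]; first by rewrite !mul0r mulr0.
have {5 6}-> : nat_of_ord m = m./2.*2 by lia.
move: m./2 => s; rewrite -[s.*2]mul2n exprM sqrrN sqrCi mul2n /super_catalan.
have := natfact_neq0 C p; have := natfact_neq0 C s.
have := natfact_neq0 C (p + s); rewrite [(s + p)%N]addnC.
have : (-1) ^+ s * (-1) ^+ s = 1 :> C by rewrite -exprD addnn -signr_odd odd_double.
move=> e h1 h2 h3.
transitivity ((p.*2)`!%:R / p`!%:R * (s`!%:R^-1 / (p + s)`!%:R) * E`_m * (s.*2)`!%:R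
  * ((-1) ^+ s * (-1) ^+ s)); first by ring.
by rewrite e; field; rewrite h1 h2 h3.
Qed.

End DiagonalIdentity.

(** * Limits and nonpositive zeros *)

Section ComplexLimits.
Variable C : numFieldType.
Implicit Types (u v : nat -> C) (l c : C).

(* Stated with epsilons because R[i] has no topology of its own. *)
Definition clim u l := forall e : C, 0 < e ->
  exists N, forall n, (N <= n)%N -> `|u n - l| <= e.

Lemma clim_cst c : clim (fun=> c) c.
Proof. by move=> e e0; exists 0%N => n _; rewrite subrr normr0 ltW. Qed.

Lemma climD u v l m : clim u l -> clim v m -> clim (fun n => u n + v n) (l + m).
Proof.
move=> ul vm e e0; have e20 : 0 < e / 2 by rewrite divr_gt0.
have [N1 h1] := ul _ e20; have [N2 h2] := vm _ e20.
exists (maxn N1 N2) => n; rewrite geq_max => /andP[/h1 le1 /h2 le2].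
rewrite opprD addrACA (le_trans (ler_normD _ _)) // (le_trans (lerD le1 le2)) //.
by rewrite -splitr.
Qed.

Lemma climMl c u l : clim u l -> clim (fun n => c * u n) (c * l).
Proof.
move=> ul e e0; have k0 : 0 < `|c| + 1 by rewrite ltr_wpDl.
have [N h] := ul _ (divr_gt0 e0 k0); exists N => n /h le_ue.
rewrite -mulrBr normrM (le_trans (ler_wpM2l _ le_ue)) // mulrCA.
by rewrite ler_piMr ?(ltW e0) // ler_pdivrMr // mul1r lerDl.
Qed.

Lemma clim_sum (I : Type) (r : seq I) (u : I -> nat -> C) (l : I -> C) :
  (forall i, clim (u i) (l i)) ->
  clim (fun n => \sum_(i <- r) u i n) (\sum_(i <- r) l i).
Proof.
move=> ul; elim: r => [|i r IH].
  rewrite big_nil => e e0; exists 0%N => n _.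
  by rewrite big_nil subrr normr0 ltW.
rewrite big_cons => e /(climD (ul i) IH)[N h]; exists N => n /h.
by rewrite big_cons.
Qed.

Lemma clim_shift u l k : clim u l -> clim (fun n => u (n + k)%N) l.
Proof.
by move=> ul e /ul[N h]; exists N => n Nn; apply: h; rewrite (leq_trans Nn) ?leq_addr.
Qed.

Lemma clim_eq u v l : (forall n, u n = v n) -> clim u l -> clim v l.
Proof. by move=> uv ul e /ul[N h]; exists N => n /h; rewrite uv. Qed.

Lemma clim_dominated u v l k : 0 <= k ->
  clim u 0 -> clim v l -> (forall n, `|v n| <= k * `|u n|) -> l = 0.
Proof.
move=> k0 u0 vl vu; apply/eqP; rewrite -normr_eq0; apply/negPn/negP => l0.
have l0' : 0 < `|l| by rewrite lt_def l0 normr_ge0.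
have k1 : 0 < k + 1 by rewrite ltr_wpDl.
have [N1 h1] := vl _ (divr_gt0 l0' (ltr0n C 3)).
have [N2 h2] := u0 _ (divr_gt0 (divr_gt0 l0' (ltr0n C 3)) k1).
have := h1 _ (leq_maxl N1 N2); have := h2 _ (leq_maxr N1 N2).
move: (maxn _ _) => n; rewrite subr0 => le2; rewrite distrC => le1.
have le3 : `|v n| <= `|l| / 3%:R.
  apply: le_trans (vu n) _; apply: (@le_trans _ _ ((k + 1) * `|u n|)).
    by rewrite ler_wpM2r // lerDl.
  by rewrite mulrC -ler_pdivlMr.
have : `|l| <= `|l| / 3%:R + `|l| / 3%:R.
  rewrite -{1}[l](subrK (v n)) (le_trans (ler_normD _ _)) //.
  exact: lerD le1 le3.
move=> /le_lt_trans lt; suff /lt : `|l| / 3%:R + `|l| / 3%:R < `|l| by rewrite ltxx.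
rewrite -mulrDr gtr_pMr // -mulr2n -[_^-1 *+ 2]mulr_natl ltr_pdivrMr ?ltr0n // mul1r.
by rewrite ltr_nat.
Qed.

Lemma poly_eval_eq0 (g : {poly C}) : (forall z, g.[z] = 0) -> g = 0.
Proof.
move=> g0; apply: (@roots_geq_poly_eq0 _ _ [seq i%:R | i <- iota 0 (size g)]).
- by apply/allP => _ /mapP[i _ ->]; apply/rootP.
- by rewrite map_inj_uniq ?iota_uniq // => i j /eqP; rewrite eqr_nat => /eqP.
- by rewrite size_map size_iota.
Qed.

End ComplexLimits.

Section ZeroFreeLimit.
Variable C : numClosedFieldType.

(** If the limit vanishes at a point of the half plane, [zfree_growth] with the common degree bound
    forces it to vanish everywhere. *)
Lemma zfree_lim (t : C) n (gs : nat -> {poly C}) (g : {poly C}) : t \is Num.real ->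
  (forall N, (size (gs N) <= n.+1)%N) ->
  (forall N, gs N = 0 \/ zfree t (gs N)) ->
  (forall z, clim (fun N => (gs N).[z]) g.[z]) ->
  g = 0 \/ zfree t g.
Proof.
move=> tR sgs gsP lim.
have [->|g0] := eqVneq g 0; [by left | right => z0 tz].
apply: contraNN g0 => /rootP gz0; apply/eqP/poly_eval_eq0 => w.
have := lim z0; rewrite gz0 => lim0.
apply: (clim_dominated _ lim0 (lim w)); last first.
  move=> N; case: (gsP N) => [->|gsF]; first by rewrite !horner0 normr0 mulr0.
  exact: (zfree_growth w tR gsF (sgs N) tz).
by rewrite exprn_ge0 // addr_ge0 // divr_ge0 // subr_ge0 ltW.
Qed.

(** Derivatives of [g] of order at least [n] are zero, so only finitely many coefficients of the
    operators matter, however large their degrees. *)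
Lemma horner_dop_lim n (A : nat -> {poly C}) (B g : {poly C}) z : (size g <= n)%N ->
  (forall i, (i < n)%N -> clim (fun N => (A N)`_i) B`_i) ->
  clim (fun N => (dop (A N) g).[z]) (dop B g).[z].
Proof.
move=> sg AB; rewrite (dop_truncate _ sg) horner_sum.
apply: (@clim_eq _ (fun N => \sum_(i < n) ((g^`(i)).[z] * (A N)`_i))).
  move=> N; rewrite (dop_truncate _ sg) horner_sum; apply: eq_bigr => i _.
  by rewrite hornerZ mulrC.
apply: clim_sum => i; rewrite hornerZ mulrC; apply: climMl; exact: AB.
Qed.

Lemma size_dop (A g : {poly C}) n : (size g <= n)%N -> (size (dop A g) <= n)%N.
Proof.
move=> sg; apply: leq_trans (size_sum _ _ _) _; apply/bigmax_leqP => i _.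
apply: leq_trans (size_scale_leq _ _) _; apply: leq_trans sg.
elim: (nat_of_ord i) => [|k IH]; first by rewrite derivn0.
rewrite derivnS; apply: leq_trans IH.
by case: (eqVneq g^`(k) 0) => [->|/lt_size_deriv/ltnW//]; rewrite deriv0.
Qed.

End ZeroFreeLimit.

Section FallingRatio.
Variable R : realType.
Local Notation C := R[i].

(** For n > 0 this is the product of the 1 - j / n over j < k. *)
Definition falling_ratio n k : R := (n ^_ k)%:R / n%:R ^+ k.

Lemma falling_ratio_ge0 n k : 0 <= falling_ratio n k.
Proof. by rewrite divr_ge0. Qed.

Lemma falling_ratioS n k :
  falling_ratio n k.+1 = falling_ratio n k * ((n - k)%:R / n%:R).
Proof. by rewrite /falling_ratio ffactnSr natrM exprSr invfM mulrACA. Qed.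

Lemma falling_ratio_le1 n k : falling_ratio n k <= 1.
Proof.
elim: k => [|k IH]; first by rewrite /falling_ratio ffactn0 expr0 divr1.
rewrite falling_ratioS mulr_ile1 ?falling_ratio_ge0 ?divr_ge0 //.
have [->|n0] := posnP n; first by rewrite invr0 mulr0.
by rewrite ler_pdivrMr ?ltr0n // mul1r ler_nat leq_subr.
Qed.

(** Passing from k to k + 1 costs at most k / n, and k^2 + k <= (k + 1)^2. *)
Lemma falling_ratio_near n k : (0 < n)%N ->
  1 - falling_ratio n k <= (k ^ 2)%:R / n%:R.
Proof.
move=> n0; have n0' : 0 < n%:R :> R by rewrite ltr0n.
elim: k => [|k IH].
  by rewrite /falling_ratio ffactn0 expr0 divr1 subrr mul0r.
have kn : 1 - (n - k)%:R / n%:R <= k%:R / n%:R :> R.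
  rewrite lerBlDl -mulrDl ler_pdivlMr // mul1r -natrD ler_nat.
  by rewrite addnC -leq_subLR.
have f0 := falling_ratio_ge0 n k; have f1 := falling_ratio_le1 n k.
rewrite falling_ratioS.
apply: (@le_trans _ _ ((k ^ 2)%:R / n%:R + k%:R / n%:R)).
  set x := _ / n%:R in kn *; set f := falling_ratio n k in IH f0 f1 *.
  have kn0 : 0 <= k%:R / n%:R :> R by rewrite divr_ge0.
  have : f * (1 - x) <= k%:R / n%:R.
    apply: le_trans (ler_wpM2l f0 kn) _; exact: ler_piMl.
  by move: IH; set a := _ / n%:R; set b := _ / n%:R; lra.
by rewrite -mulrDl ler_pM2r ?invr_gt0 // -natrD ler_nat; lia.
Qed.

Lemma clim_falling_ratio k : clim (fun n => (falling_ratio n.+1 k)%:C : C) 1.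
Proof.
move=> e e0; have eE : e = (complex.Re e)%:C by rewrite RRe_real // gtr0_real.
move: e0; rewrite eE ltcR => e0.
exists (Num.bound ((k ^ 2)%:R / complex.Re e)) => n Nn.
have -> : (falling_ratio n.+1 k)%:C - 1 = (falling_ratio n.+1 k - 1)%:C :> C.
  by rewrite rmorphB rmorph1.
rewrite normc_def /= expr0n addr0 sqrtr_sqr lecR.
rewrite ler0_norm ?subr_le0 ?falling_ratio_le1 // opprB.
rewrite (le_trans (falling_ratio_near k (ltn0Sn n))) //.
rewrite ler_pdivrMr ?ltr0n // mulrC -ler_pdivrMr //.
apply: le_trans (ltW (archi_boundP _)) _; first by rewrite divr_ge0 // ltW.
by rewrite ler_nat leqW.
Qed.

Lemma clim_binom_ratio s : clim (fun n => binom_ratio C n.+1 s) (s`!%:R)^-1.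
Proof.
rewrite -[_^-1]mulr1; apply: (clim_eq _ (climMl _ (@clim_falling_ratio s))) => n.
rewrite /binom_ratio /falling_ratio rmorphM fmorphV rmorphXn !rmorph_nat.
rewrite -bin_ffact natrM mulrA; congr (_ * _).
by rewrite [X in _ * X]mulrC mulrA mulVf ?mul1r ?natfact_neq0.
Qed.

Lemma coef_bessel_binom p N i :
  (bessel_poly p (binom_ratio C N) N.*2)`_i =
  if odd i then 0 else (- 1) ^+ i./2 * binom_ratio C N i./2 / (i./2 + p)`!%:R.
Proof.
rewrite coef_poly; case: (boolP (odd i)) => [_|iE]; first by rewrite if_same.
case: ltnP => // Ni; rewrite /binom_ratio bin_small ?mul0r ?mulr0 ?mul0r //.
lia.
Qed.

(** Limit of the Laguerre case. The constant coefficient 1 / p! makes the limit nonzero, which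
    leaves only the zero-free alternative; truncation at degree [n] is harmless on [h]. *)
Lemma zfree_dop_bessel (t : C) p n (h : {poly C}) : t \is Num.real ->
  h != 0 -> (size h <= n.+1)%N -> zfree t h ->
  zfree t (dop (bessel_poly p (fun s => (s`!%:R)^-1) n) h).
Proof.
move=> tR h0 sh hP.
(* The index [N.+1] avoids N = 0, where -X^2 / N makes no sense. *)
pose A N := bessel_poly p (binom_ratio C N.+1) N.+1.*2.
have A00 N : (A N)`_0 != 0.
  by rewrite coef_bessel_binom /= expr0 mul1r /binom_ratio bin0 expr0 divr1 mul1r invr_eq0 natfact_neq0.
have A0 N : A N != 0 by apply: contraNneq (A00 N) => ->; rewrite coef0.
have lim z : clim (fun N => (dop (A N) h).[z])
    (dop (bessel_poly p (fun s => (s`!%:R)^-1) n) h).[z].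
  apply: (horner_dop_lim z sh) => i iN; rewrite coef_poly iN.
  apply: clim_eq => [N|]; first by rewrite coef_bessel_binom.
  case: (odd i); first exact: clim_cst.
  set f := (_ + p)`!%:R; rewrite mulrAC.
  by apply: clim_eq (climMl _ (clim_binom_ratio i./2)) => N; rewrite mulrAC.
case: (zfree_lim tR (fun N => size_dop (A N) sh) _ lim) => // [N|/eqP].
  apply: zfree_dop => // [z|]; last by right.
  exact: bessel_poly_binom_root.
rewrite (negPf (dop_neq0 _ h0)) // coef_poly /= expr0 mul1r.
by rewrite fact0 invr1 mul1r invr_eq0 natfact_neq0.
Qed.

End FallingRatio.

Section LopRoots.
Variable R : realType.
Local Notation C := R[i].

Lemma lopnZ (F : comNzRingType) p (c : F) (a : nat -> F) k :
  lopn p (fun i => c * a i) k = c ^+ 2 * lopn p a k.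
Proof.
rewrite /lopn mulrDr exprMn; congr (_ + _); first by ring.
rewrite mulr_sumr; apply: eq_bigr => j _.
by case: ifP => _; [ring | rewrite !mulr0 !mul0r mulr0].
Qed.

Lemma eq_lopn (F : comNzRingType) p (a b : nat -> F) k :
  a =1 b -> lopn p a k = lopn p b k.
Proof.
by move=> ab; rewrite /lopn ab; congr (_ + _); apply: eq_bigr => j _; rewrite !ab.
Qed.

(* For r != 0 the only zero is -i (w / r + r / w). *)
Lemma zfree_quadratic (w r : C) : 0 < 'Re w -> 0 <= r ->
  exists2 t : C, t < 0 &
    zfree t (((w ^+ 2 + r ^+ 2)%:P + (r * w) *: 'X) \Po (- 'i *: 'X)).
Proof.
move=> w0 r0; have wn0 : w != 0 by apply: contraTneq w0 => ->; rewrite raddf0 ltxx.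
have [->|rn0] := eqVneq r 0.
  exists (-1); first by rewrite oppr_lt0.
  rewrite mul0r scale0r addr0 expr0n addr0 comp_polyC.
  by apply: zfreeC; rewrite expf_neq0.
have rgt : 0 < r by rewrite lt_def rn0.
(* The exact height of the zero; it is negative because 1 / w has positive real part along with
   w. *)
exists (- 'Re (w / r + r / w)).
  rewrite oppr_lt0 raddfD addr_gt0 //=.
    by rewrite ReMr ?divr_gt0 // rpredV gtr0_real.
  rewrite ReMl ?gtr0_real // mulr_gt0 // ReV divr_gt0 // exprn_gt0 //.
  by rewrite normr_gt0.
move=> z; rewrite /root horner_comp !(hornerD, hornerC, hornerZ, hornerX).
apply: contraTneq => zE;
have -> : z = - 'i * (w / r + r / w).
  have : (r * w) * (z + 'i * (w / r + r / w)) = 0.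
    have i2 : 'i * 'i = -1 :> C by rewrite -expr2 sqrCi.
    transitivity (r * w * z + 'i * (w ^+ 2 + r ^+ 2)); first by field; rewrite rn0 wn0.
    have -> : w ^+ 2 + r ^+ 2 = r * w * ('i * z).
      apply/eqP; rewrite -subr_eq0; apply/eqP; move: zE.
      by move: (w ^+ 2 + r ^+ 2) => u <-; ring.
    transitivity (r * w * z * (1 + 'i * 'i)); first by ring.
    by rewrite i2 subrr mulr0.
  move/eqP; rewrite !mulf_eq0 (negPf rn0) (negPf wn0) /= addr_eq0 => /eqP->.
  by rewrite mulNr.
by rewrite mulNr raddfN /= ImMil ltxx.
Qed.

(** The largest of finitely many negative thresholds is still negative. *)
Lemma zfree_prod_quadratic (w : C) (rs : seq C) : 0 < 'Re w ->
  all (fun r => r <= 0) rs ->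
  exists2 t : C, t < 0 &
    zfree t (\prod_(r <- rs) ((w ^+ 2 + r ^+ 2)%:P + (- r * w) *: 'X) \Po (- 'i *: 'X)).
Proof.
move=> w0; elim: rs => [|r rs IH] /=.
  exists (-1); first by rewrite oppr_lt0.
  by rewrite big_nil -polyC1 comp_polyC; apply: zfreeC; rewrite oner_neq0.
case/andP=> r0 /IH[t1 t10 h1].
have [|t2 t20 h2] := zfree_quadratic w0 (_ : 0 <= - r); first by rewrite oppr_ge0.
have mono (t t' : C) g : t <= t' -> zfree t g -> zfree t' g.
  by move=> tt' h z /(le_lt_trans tt'); exact: h.
rewrite big_cons rmorphM /=; rewrite sqrrN in h2.
have /orP[t12|t21] := real_leVge (ltr0_real t10) (ltr0_real t20).
  by exists t2 => //; apply: zfreeM => //; apply: mono h1.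
by exists t1 => //; apply: zfreeM => //; apply: mono h2.
Qed.

(** A purely imaginary square root would make [z] nonpositive, so one of the two roots lies strictly
    to the right. *)
Lemma sqrt_right_half (z : C) : ~~ (z <= 0) ->
  exists2 w : C, w ^+ 2 = z & 0 < 'Re w.
Proof.
move=> z0; have wz := sqrtCK z; move: (sqrtC z) wz => w wz.
have /orP[] := real_leVge (Creal_Re w) (real0 C); rewrite le_eqVlt; last first.
- case/orP=> [/eqP|]; last by exists w.
  move=> w0; case/negP: z0; rewrite -wz [w]Crect -w0 add0r exprMn sqrCi mulN1r.
  by rewrite oppr_le0 real_exprn_even_ge0.
case/orP=> [/eqP|w0].
  move=> w0; case/negP: z0; rewrite -wz [w]Crect w0 add0r exprMn sqrCi mulN1r.
  by rewrite oppr_le0 real_exprn_even_ge0.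
by exists (- w); rewrite ?sqrrN // raddfN oppr_gt0.
Qed.

Lemma lopn_roots_le0 p (c : C) (rs : seq C) z : (0 < p)%N -> c != 0 ->
  all (fun r => r <= 0) rs ->
  root (\poly_(k < (size rs).+1)
     lopn p (nth 0 (c *: \prod_(r <- rs) ('X - r%:P))) k) z -> z <= 0.
Proof.
move=> p0 c0 rs0; set N := size rs; set q := \prod_(r <- rs) _.
apply: contraTT => /sqrt_right_half[w <- w0].
have qE : q = \prod_(r <- rs) ((- r)%:P + 1 *: 'X).
  by apply: eq_bigr => r _; rewrite scale1r addrC polyCN.
have sq : (size q <= N.+1)%N by rewrite qE size_prod_affine.
have : (- 1) ^+ p * 2 * (\sum_(k < N.+1) lopn p (nth 0 q) k * w ^+ k.*2) != 0 :> C.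
  rewrite -hom_diag // qE !hom_prod -big_split /=.
  (* Factor by factor this is (w X - r)(w - r X) = (w^2 + r^2) X - r w (1 + X^2). *)
  rewrite [X in _ * X](_ : _ = hom N (\prod_(r <- rs)
      ((w ^+ 2 + r ^+ 2)%:P + (- r * w) *: 'X)) (1 + 'X^2) 'X); last first.
    rewrite hom_prod; apply: eq_bigr => r _; rewrite !scale1r -!mul_polyC !mulr1.
    rewrite -['X^2]/('X * 'X) !expr2 !(polyCD, polyCM, polyCN); ring.
  rewrite hom_von_szily -dop_von_szily ?size_prod_affine //.
  rewrite !mulf_neq0 ?invr_eq0 ?natfact_neq0 ?signr_eq0 //.
  have [t t0 hP] := zfree_prod_quadratic w0 rs0.
  have := zfree_dop_bessel p (ltr0_real t0) _ _ hP.
  set H := _ \Po _ => free; apply: (free N) => [||]; rewrite ?raddf0 //.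
    have : ~~ root H 0 by apply: hP; rewrite raddf0.
    by apply: contraNneq => ->; rewrite root0.
  apply: leq_trans (size_comp_poly_leq _ _) _.
  rewrite size_scale ?oppr_eq0 ?neq0Ci // size_polyX muln1.
  by have := size_prod_affine rs (fun r => w ^+ 2 + r ^+ 2) (fun r => - r * w); case: (size _).
apply: contraNN; rewrite /root => /eqP h.
rewrite mulf_eq0; apply/orP; right.
(* The operator is quadratic, so the scalar [c] enters only through the nonzero factor [c ^+ 2]. *)
move: h; rewrite horner_poly => h; rewrite -(mulrI_eq0 _ (mulfI (expf_neq0 2 c0))).
apply/eqP; rewrite -[RHS]h mulr_sumr; apply: eq_bigr => k _.
rewrite -mul2n exprM mulrA -lopnZ; congr (_ * _); apply: eq_lopn => i.
by rewrite coefZ.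
Qed.

End LopRoots.

(** * Jensen polynomials *)

Lemma coef_ge0_of_roots (C : numClosedFieldType) (P : {poly C}) :
  (forall z, root P z -> z <= 0) -> 0 <= lead_coef P -> forall i, 0 <= P`_i.
Proof.
move=> P0 l0 i; have [rs PE] := closed_field_poly_normal P.
have [lz|lnz] := eqVneq (lead_coef P) 0.
  by rewrite PE lz scale0r coef0.
suff /polyOverP/(_ i) : P \is a polyOver Num.nneg by rewrite nnegrE.
rewrite PE polyOverZ //; rewrite big_seq rpred_prod // => r rrs.
by rewrite rpredD ?polyOverX // -polyCN polyOverC nnegrE oppr_ge0 P0 // PE rootZ // root_prod_XsubC.
Qed.

Section Lopn.
Variable F : comNzRingType.
Implicit Type a : nat -> F.

Lemma lopn_top p a d : (forall k, (d < k)%N -> a k = 0) ->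
  lopn p a d = 'C((2 * p).-1, p)%:R * a d ^+ 2.
Proof.
move=> ad; rewrite /lopn big_nat big1 ?addr0 // => j /andP[j0 _].
by rewrite [a (d + j)%N]ad ?mulr0 // -addn1 leq_add2l.
Qed.

Lemma lopn_eq0 p a d k : (forall k, (d < k)%N -> a k = 0) -> (d < k)%N ->
  lopn p a k = 0.
Proof.
move=> ad dk; rewrite lopn_top ?ad ?expr0n ?mulr0 // => l kl.
by rewrite ad // (ltn_trans dk).
Qed.

End Lopn.

Section Jensen.
Variable R : realType.
Local Notation C := R[i].

Lemma LopE p (a : nat -> R) k : Lop p a k = lopn p a k.
Proof.
rewrite /Lop /lopn; congr (_ + _); apply: eq_bigr => j _.
congr (_ * _ * _).
have [jk|kj] := leqP j k; first by rewrite subzn.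
have -> : k%:Z - j%:Z = Negz (j - k).-1 by rewrite NegzE; lia.
by [].
Qed.

Lemma lopn_complex p (a : nat -> R) k :
  (lopn p a k)%:C = lopn p (fun i => (a i)%:C) k :> C.
Proof.
rewrite /lopn rmorphD rmorphM rmorphXn rmorph_nat rmorph_sum; congr (_ + _).
apply: eq_bigr => j _; rewrite !rmorphM rmorphXn rmorphN1 rmorph_nat.
by congr (_ * _ * _); case: ifP => //; rewrite rmorph0.
Qed.

(* Coefficients of the n-th Jensen polynomial of sum_k a_k z^k at z / n. *)
Definition jensen (a : nat -> R) n k : R := a k * falling_ratio R n k.

Definition jensen_poly a n : {poly C} := \poly_(k < n.+1) (jensen a n k)%:C.

Lemma jensen_eq0 a n k : (n < k)%N -> jensen a n k = 0.
Proof. by move=> nk; rewrite /jensen /falling_ratio ffact_small // mul0r mulr0. Qed.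

Lemma coef_jensen_poly a n k : (jensen_poly a n)`_k = (jensen a n k)%:C.
Proof. by rewrite coef_poly; case: ltnP => // nk; rewrite jensen_eq0. Qed.

(* Up to scaling, the Jensen polynomial is the reversal of phi(D) X^n. *)
Lemma horner_jensen_poly a n z : z != 0 -> (jensen_poly a n.+1).[z] =
  (z / n.+1%:R) ^+ n.+1 *
  (dop (\poly_(k < n.+2) (a k)%:C) 'X^(n.+1)).[n.+1%:R / z].
Proof.
move=> z0; set N := n.+1; have N0 : N%:R != 0 :> C by rewrite pnatr_eq0.
rewrite (@dop_wide _ N.+1) ?size_poly // horner_sum mulr_sumr horner_poly.
apply: eq_bigr => k _; rewrite coef_poly ltn_ord hornerZ derivnXn hornerMn hornerXn.
have kN : (k <= N)%N by rewrite -ltnS.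
rewrite /jensen /falling_ratio !rmorphM fmorphV rmorphXn !rmorph_nat.
move: (nat_of_ord k) kN => {}k kN; set x := N%:R / z.
have x0 : x != 0 by rewrite mulf_neq0 ?invr_eq0.
have -> : z / N%:R = x^-1 by rewrite /x invf_div.
have -> : z = N%:R / x by rewrite /x invf_div mulrCA divff ?mulr1.
have -> : x^-1 ^+ N = (x ^+ (N - k) * x ^+ k)^-1 by rewrite -exprD subnK // exprVn.
rewrite -[_ *+ N ^_ k]mulr_natr expr_div_n.
by field; rewrite !expf_neq0.
Qed.

Section Approximated.
Variables (a : nat -> R) (Q : nat -> {poly R}).
Hypothesis a_ge0 : forall k, 0 <= a k.
Hypothesis QR : forall m, real_rooted (Q m).
Hypothesis Qa : forall k, clim (fun m => ((Q m)`_k)%:C : C) (a k)%:C.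

(** Each (Q m)(D) X^n is zero free in the upper half plane, and only the convergence of the
    coefficients up to degree [n] is needed to pass to the limit. *)
Lemma zfree_dop_limit n : let g := dop (\poly_(k < n.+1) (a k)%:C) 'X^n in
  g = 0 \/ zfree (0 : C) g.
Proof.
move=> g; have sX : (size ('X^n : {poly C}) <= n.+1)%N by rewrite size_polyXn.
apply: (zfree_lim (real0 C) (fun m => size_dop (complex_poly (Q m)) sX)).
  move=> m; apply: zfree_dop (real0 C) _ _ _.
  (* The zero polynomial would have the nonreal root i. *)
  - apply/eqP => Q0; have := @QR m 'i%R.
    rewrite Q0 root0 => /(_ isT) /Creal_ImP; rewrite Im_i => /eqP.
    by rewrite oner_eq0.
  - by move=> z; apply: QR.
  - right=> y y0; rewrite /root hornerXn expf_neq0 //.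
    by apply: contraTneq y0 => ->; rewrite raddf0 ltxx.
move=> z; apply: (horner_dop_lim z sX) => i iN.
rewrite coef_poly iN; apply: clim_eq (Qa i) => m.
by rewrite /complex_poly coef_map.
Qed.

(** A zero in the upper half plane is traded for its conjugate, since u -> n.+1 / u maps the lower
    half plane to the upper one, where phi(D) X^(n+1) is zero free or identically zero. A positive
    zero would force all the nonnegative coefficients to vanish. *)
Lemma jensen_roots n z : jensen_poly a n.+1 != 0 ->
  root (jensen_poly a n.+1) z -> z <= 0.
Proof.
move=> J0 zr; have jR : jensen_poly a n.+1 \is a polyOver Num.real.
  by apply/polyOverP => i; rewrite coef_jensen_poly; apply/complex_realP; exists (jensen a n.+1 i).
have zR : z \is Num.real.
  apply: (zfree_real jR) zr => y y0; apply: contraNN J0 => /(root_conj jR) yr.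
  have yn0 : y^*%R != 0.
    by rewrite conjC_eq0; apply: contraTneq y0 => ->; rewrite raddf0 ltxx.
  case: (zfree_dop_limit n.+1) => [g0|gfree].
    (* The reversal formula holds away from 0 only; the factor ['X] takes care of that point. *)
    suff : 'X * jensen_poly a n.+1 = 0.
      by move/eqP; rewrite mulf_eq0 polyX_eq0.
    apply: poly_eval_eq0 => u; rewrite hornerM hornerX.
    have [->|u0] := eqVneq u 0; first by rewrite mul0r.
    by rewrite horner_jensen_poly // g0 horner0 !mulr0.
  move: yr; rewrite /root horner_jensen_poly // mulf_eq0 => /orP[].
    by rewrite expf_eq0 /= mulf_eq0 (negPf yn0) invr_eq0 pnatr_eq0.
  suff /gfree/negP : 0 < 'Im (n.+1%:R / y^*%R) by [].
  rewrite ImMl ?realn // mulr_gt0 ?ltr0n // ImV Im_conj opprK divr_gt0 //.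
  by rewrite exprn_gt0 // normr_gt0.
rewrite real_leNgt ?real0 //; apply/negP => z0.
case/eqP: J0; apply/polyP => k; rewrite coef0 coef_poly; case: ltnP => // kn.
move/rootP: zr; rewrite horner_poly => /eqP; rewrite psumr_eq0 => [|i _]; last first.
  by rewrite mulr_ge0 ?exprn_ge0 ?(ltW z0) // ler0c mulr_ge0 ?falling_ratio_ge0.
move=> /allP/(_ (Ordinal kn) (mem_index_enum _)) /=.
by rewrite mulf_eq0 expf_eq0 (gt_eqF z0) andbF orbF => /eqP.
Qed.

Definition lop_jensen_poly p n : {poly R} :=
  \poly_(k < n.+1) Lop p (jensen a n) k.

Lemma coef_lop_jensen_poly p n k :
  (lop_jensen_poly p n)`_k = Lop p (jensen a n) k.
Proof.
rewrite coef_poly; case: ltnP => // nk.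
by rewrite LopE (@lopn_eq0 _ _ _ n) // => l; apply: jensen_eq0.
Qed.

Lemma lop_jensen_roots p n z : (0 < p)%N -> jensen_poly a n.+1 != 0 ->
  root (complex_poly (lop_jensen_poly p n.+1)) z -> z <= 0.
Proof.
move=> p0 J0; have [rs JE] := closed_field_poly_normal (jensen_poly a n.+1).
have l0 : lead_coef (jensen_poly a n.+1) != 0 by rewrite lead_coef_eq0.
have rs0 : all (fun r => r <= 0) rs.
  apply/allP => r rrs; apply: (jensen_roots J0).
  by rewrite JE rootZ // root_prod_XsubC.
suff -> : complex_poly (lop_jensen_poly p n.+1) = \poly_(k < (size rs).+1)
     lopn p (nth 0 (lead_coef (jensen_poly a n.+1) *: \prod_(r <- rs) ('X - r%:P))) k.
  exact: lopn_roots_le0.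
rewrite -JE; apply/polyP => k; rewrite coef_map /= coef_lop_jensen_poly [RHS]coef_poly.
rewrite LopE lopn_complex.
rewrite (@eq_lopn _ p _ (nth 0 (jensen_poly a n.+1))); last first.
  by move=> i; rewrite coef_jensen_poly.
case: ltnP => // sk; apply: lopn_eq0 sk => l sl.
by rewrite nth_default // JE size_scale // size_prod_XsubC.
Qed.

(** All roots are nonpositive and the leading coefficient is 'C(2p - 1, p) times the square of a
    real number, so every coefficient is nonnegative. *)
Lemma lop_jensen_ge0 p n k : (0 < p)%N -> 0 <= Lop p (jensen a n.+1) k.
Proof.
move=> p0; rewrite LopE -ler0c lopn_complex.
rewrite (@eq_lopn _ p _ (nth 0 (jensen_poly a n.+1))); last first.
  by move=> i; rewrite coef_jensen_poly.
have [->|J0] := eqVneq (jensen_poly a n.+1) 0.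
  by rewrite lopn_top => [|l _]; rewrite coef0 // expr0n mulr0.
have PE l : (complex_poly (lop_jensen_poly p n.+1))`_l = lopn p (nth 0 (jensen_poly a n.+1)) l.
  rewrite coef_map coef_lop_jensen_poly LopE /= lopn_complex; apply: eq_lopn => i.
  by rewrite coef_jensen_poly.
rewrite -PE; apply: coef_ge0_of_roots; first by move=> z; apply: lop_jensen_roots.
set J := jensen_poly a n.+1 in J0 PE *.
have Jd l : ((size J).-1 < l)%N -> J`_l = 0.
  by rewrite prednK ?size_poly_gt0 // => h; rewrite nth_default.
have lE : lopn p (nth 0 J) (size J).-1 = 'C((2 * p).-1, p)%:R * lead_coef J ^+ 2.
  exact: lopn_top.
have lge0 : 0 <= 'C((2 * p).-1, p)%:R * lead_coef J ^+ 2.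
  rewrite mulr_ge0 // real_exprn_even_ge0 // /lead_coef coef_jensen_poly.
  by apply/complex_realP; exists (jensen a n.+1 (size J).-1).
suff -> : complex_poly (lop_jensen_poly p n.+1) = \poly_(l < size J) lopn p (nth 0 J) l.
  rewrite lead_coef_poly ?lE ?size_poly_gt0 //.
  rewrite mulf_neq0 ?expf_neq0 ?lead_coef_eq0 // pnatr_eq0 -lt0n bin_gt0; lia.
apply/polyP => l; rewrite PE coef_poly; case: ltnP => // Jl.
by apply: (lopn_eq0 _ Jd); rewrite prednK ?size_poly_gt0.
Qed.

End Approximated.
End Jensen.

(** * Entire power series *)

Section Topology.
Variable K : numFieldType.

Lemma cvg_clim (u : nat -> K^o) (l : K^o) :
  u n @[n --> \oo] --> l <-> clim (u : nat -> K) l.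
Proof.
split=> [/cvgrPdist_le ul e e0|ul].
  have [N _ h] := ul e e0; exists N => n Nn.
  by rewrite distrC; apply: h.
apply/cvgrPdist_le => e /ul[N h]; exists N => // n Nn.
by rewrite distrC; apply: h.
Qed.

Lemma quadratic_derivable (f : K^o -> K^o) (z l : K^o) (M : K) : 0 <= M ->
  (forall h : K, `|h| <= 1 -> `|f (z + h) - f z - h * l| <= `|h| ^+ 2 * M) ->
  derivable f z 1 /\ derive1 f z = l.
Proof.
move=> M0 fM.
have lim : h^-1 *: (f (h + z) - f z) @[h --> 0^'] --> l.
  apply/cvgrPdist_le => e e0.
  (* This radius is at most 1, and |h| below it gives |h| M <= |h| (M + e) <= e; adding [e] covers M
     = 0. *)
  have d0 : 0 < e / (M + e) by rewrite divr_gt0 // ltr_wpDl.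
  have d1 : e / (M + e) <= 1 by rewrite ler_pdivrMr ?ltr_wpDl // mul1r lerDr.
  apply/nbhs_ballP; exists (e / (M + e)) => //= h; rewrite /ball /= sub0r normrN.
  move=> he h0; have h1 : `|h| <= 1 by rewrite (le_trans (ltW he)).
  have -> : l - h^-1 *: (f (h + z) - f z) = - (h^-1 * (f (z + h) - f z - h * l)).
    rewrite mulrBr mulrA mulVf // mul1r opprB.
    by congr (_ - _); congr (_ * (f _ - _)); exact: addrC.
  rewrite normrN normrM normfV ler_pdivrMl ?normr_gt0 //.
  apply: le_trans (fM h h1) _; rewrite expr2 -mulrA ler_wpM2l //.
  have Me0 : 0 < M + e by rewrite ltr_wpDl.
  apply: (@le_trans _ _ (`|h| * (M + e))); first by rewrite ler_wpM2l // lerDl ltW.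
  by rewrite -ler_pdivlMr // ltW.
split; last by rewrite /derive1; apply: cvg_lim => //; exact: norm_hausdorff.
apply/cvg_ex; exists l; apply: cvg_trans lim; apply: near_eq_cvg.
by near=> h; rewrite /= [h *: 1]mulr1.
Unshelve. all: by end_near. Qed.

Lemma uniform_clim (Q : nat -> K^o -> K^o) (f : K^o -> K^o) (A : set K^o) :
  {uniform A, Q @ \oo --> f} <->
  (forall e : K, 0 < e -> exists N, forall n, (N <= n)%N ->
     forall z, A z -> `|Q n z - f z| <= e).
Proof.
split=> [QF e e0|QF].
  have [N _ h] : \forall n \near \oo, [set g : {uniform` A -> K^o} | forall y, A y -> ball (f y) e (g y)] (Q n).
    apply: QF; apply/uniform_nbhs; exists [set xy | ball xy.1 e xy.2]; split => //.
    exact: entourage_ball (PosNum e0).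
  exists N => n Nn z Az; rewrite distrC.
  by have := h n Nn z Az; rewrite -ball_normE => /ltW.
move=> P /uniform_nbhs[E [entE EP]].
have [e e0 eE] : exists2 e : K, 0 < e & [set xy : K^o * K^o | ball xy.1 e xy.2] `<=` E.
  by move: entE; rewrite -entourage_ballE => -[e e0 h]; exists e.
have e20 : 0 < e / 2 by rewrite divr_gt0.
have [N h] := QF _ e20; exists N => // n Nn; apply: EP => y Ay; apply: eE.
rewrite /= -ball_normE /= distrC (le_lt_trans (h n Nn y Ay)) //.
by rewrite ltr_pdivrMr // ltr_pMr // ltr1n.
Qed.

End Topology.

(** * Cauchy's coefficient estimate for polynomials *)

Section Cauchy.
Variable C : numClosedFieldType.

Lemma prim_root_exists n : (0 < n)%N -> exists z : C, n.-primitive_root z.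
Proof.
pose q : {poly C} := 'X^n - 1; have [r Dq] := closed_field_poly_normal q.
move=> n0; rewrite (monicP _) ?monicXnsubC // scale1r in Dq.
have rn1 : all n.-unity_root r by apply/allP=> z; rewrite -root_prod_XsubC -Dq.
have sz_r : (n < (size r).+1)%N.
  by rewrite -(size_prod_XsubC r id) -Dq size_XnsubC.
have [|z] := hasP (has_prim_root n0 rn1 _ sz_r); last by exists z.
by rewrite -separable_prod_XsubC -Dq separable_Xn_sub_1 // pnatr_eq0 -lt0n.
Qed.

Lemma sum_unity_root n (x : C) : x ^+ n = 1 ->
  \sum_(j < n) x ^+ j = if x == 1 then n%:R else 0.
Proof.
move=> xn; have [->|x1] := eqVneq x 1.
  by under eq_bigr do rewrite expr1n; rewrite sumr_const card_ord.
apply/eqP; rewrite -(mulrI_eq0 _ (mulfI (_ : x - 1 != 0))) ?subr_eq0 //.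
by rewrite -subrX1 xn subrr.
Qed.

(* Averaging over the roots of unity replaces the contour integral. *)
Lemma poly_cauchy (d : {poly C}) (e : C) k :
  (forall z, `|z| <= 1 -> `|d.[z]| <= e) -> `|d`_k| <= e.
Proof.
move=> de; have e0 : 0 <= e by apply: le_trans (de 0 _); rewrite ?normr0.
(* With [N] above both [k] and the degree, [k] is the only index below [N] congruent to [k]; the
   exponent [N - k] plays the role of -k. *)
pose N := maxn (size d) k.+1.
have kN : (k < N)%N by rewrite leq_maxr.
have N0 : (0 < N)%N by apply: leq_trans kN.
have [x xN] := prim_root_exists N0.
have x1 : `|x| = 1.
  have /eqP := congr1 Num.norm (prim_expr_order xN).
  by rewrite normrX normr1 pexpr_eq1 // => /eqP.
have dN : \sum_(j < N) d.[x ^+ j] * (x ^+ j) ^+ (N - k) = N%:R * d`_k.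
  transitivity (\sum_(i < N) d`_i * \sum_(j < N) (x ^+ (i + (N - k))) ^+ j).
    rewrite [RHS](eq_bigr (fun i : 'I_N => \sum_(j < N) d`_i * (x ^+ (i + (N - k))) ^+ j)); last first.
      by move=> i _; rewrite mulr_sumr.
    rewrite exchange_big; apply: eq_bigr => j _ /=.
    rewrite (@horner_coef_wide _ N) ?leq_maxl // mulr_suml; apply: eq_bigr => i _.
    by rewrite -mulrA -exprD -!exprM mulnC.
  rewrite (bigD1 (Ordinal kN)) //= [X in _ + X]big1 => [|i ik].
    rewrite sum_unity_root; last by rewrite -exprM mulnC exprM (prim_expr_order xN) expr1n.
    rewrite subnKC ?(ltnW kN) // (prim_expr_order xN) eqxx addr0 mulrC.
    by [].
  rewrite sum_unity_root; last by rewrite -exprM mulnC exprM (prim_expr_order xN) expr1n.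
  rewrite -(prim_order_dvd xN); case: dvdnP => [[c cE]|_]; last by rewrite mulr0.
  case/negP: ik; rewrite -val_eqE /=; apply/eqP.
  have := ltn_ord i; case: c cE => [|[|c]]; lia.
rewrite -(ler_pM2l (_ : 0 < N%:R)) ?ltr0n //.
rewrite -[X in X * `|_|]ger0_norm // -normrM -dN.
apply: le_trans (ler_norm_sum _ _ _) _.
rewrite mulr_natl -[X in e *+ X]card_ord -sumr_const; apply: ler_sum => j _.
by rewrite normrM !normrX x1 !expr1n mulr1 de // normrX x1 expr1n.
Qed.

End Cauchy.

(** * Estimates for coefficients and partial sums *)

Section PowerSums.
Variable C : numFieldType.
Implicit Types (c u : nat -> C) (z r B : C).

Definition psum c z n : C := \sum_(k < n) c k * z ^+ k.

(** Infinite radius of convergence as a boundedness condition. Used at radius 2r, it bounds the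
    terms on |z| <= r by a geometric sequence of ratio 1/2. *)
Definition entire_coef c := forall r, 0 <= r -> exists B, forall k, `|c k| * r ^+ k <= B.

Lemma clim_norm_le u l M N : clim u l ->
  (forall n, (N <= n)%N -> `|u n| <= M) -> `|l| <= M.
Proof.
move=> ul uM; have M0 : 0 <= M by apply: le_trans (uM N _).
rewrite real_leNgt ?ger0_real //; apply/negP => Ml.
have e0 : 0 < (`|l| - M) / 2 by rewrite divr_gt0 // subr_gt0.
have [N' h] := ul _ e0.
have := h _ (leq_maxr N N'); have := uM _ (leq_maxl N N').
move: (maxn _ _) => n unM; rewrite distrC => le1.
have : `|l| <= (`|l| - M) / 2 + M.
  rewrite -{1}[l](subrK (u n)) (le_trans (ler_normD _ _)) //; exact: lerD.
rewrite -lerBlDr => /le_lt_trans lt; suff /lt : (`|l| - M) / 2 < `|l| - M by rewrite ltxx.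
by rewrite ltr_pdivrMr // ltr_pMr ?subr_gt0 // ltr1n.
Qed.

Lemma clim_unique u l m : clim u l -> clim u m -> l = m.
Proof.
move=> ul um; apply/eqP; rewrite -subr_eq0 -normr_le0.
have h : clim (fun n => u n + -1 * u n) (l + -1 * m) by apply: climD => //; exact: climMl.
rewrite mulN1r in h; apply: (clim_norm_le (N := 0) h) => n _.
by rewrite mulN1r subrr normr0.
Qed.

Lemma geometric_tail u B n m : (forall k, `|u k| * 2 ^+ k <= B) -> (n <= m)%N ->
  \sum_(n <= k < m) `|u k| <= 2 * B / 2 ^+ n.
Proof.
move=> uB nm; have p0 k : 0 < 2 ^+ k :> C by rewrite exprn_gt0.
have B0 : 0 <= B by apply: le_trans (uB 0); rewrite mulr_ge0.
(* Adding the expected remainder beyond [m] makes the bound inductive. *)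
suff: \sum_(n <= k < m) `|u k| + 2 * B / 2 ^+ m <= 2 * B / 2 ^+ n.
  by apply: le_trans; rewrite lerDl divr_ge0 ?mulr_ge0 // ltW.
elim: m nm => [|m IH]; first by rewrite leqn0 => /eqP ->; rewrite big_geq // add0r.
rewrite leq_eqVlt => /orP[/eqP<-|]; first by rewrite big_geq // add0r.
rewrite ltnS => nm; rewrite big_nat_recr //= -addrA; apply: le_trans _ (IH nm).
rewrite lerD2l exprS invfM mulrACA divff ?mul1r ?pnatr_eq0 //.
have -> : 2 * B / 2 ^+ m = B / 2 ^+ m + B / 2 ^+ m by rewrite -mulrA mulr_natl mulr2n.
by rewrite lerD2r ler_pdivlMr.
Qed.

Lemma geometric_sum u B n : (forall k, `|u k| * 2 ^+ k <= B) ->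
  `|\sum_(k < n) u k| <= 2 * B.
Proof.
move=> uB; apply: le_trans (ler_norm_sum _ _ _) _.
rewrite -(big_mkord xpredT (fun k => `|u k|)).
by apply: le_trans (geometric_tail uB (leq0n n)) _; rewrite expr0 divr1.
Qed.

Lemma term_bound c z r B k : `|c k| * (2 * r) ^+ k <= B -> `|z| <= r ->
  `|c k * z ^+ k| * 2 ^+ k <= B.
Proof.
move=> cB zr; apply: le_trans cB.
rewrite normrM normrX -mulrA -exprMn mulrC [_ * 2]mulrC mulrC ler_wpM2l //.
by apply: lerXn2r; rewrite ?nnegrE ?mulr_ge0 ?ler_wpM2l // (le_trans _ zr).
Qed.

Lemma psum_norm c z r B n : (forall k, `|c k| * (2 * r) ^+ k <= B) -> `|z| <= r ->
  `|psum c z n| <= 2 * B.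
Proof. by move=> cB zr; apply: (@geometric_sum (fun k => c k * z ^+ k) B) => k; apply: (term_bound (cB k) zr). Qed.

Lemma psum_tail c z r B n l : (forall k, `|c k| * (2 * r) ^+ k <= B) -> `|z| <= r ->
  clim (psum c z) l -> `|l - psum c z n| <= 2 * B / 2 ^+ n.
Proof.
move=> cB zr cl.
have h : clim (fun m => psum c z m + - psum c z n) (l + - psum c z n).
  by apply: climD => //; exact: clim_cst.
apply: (clim_norm_le (N := n) h) => m nm.
rewrite /psum -!(big_mkord xpredT (fun k => c k * z ^+ k)) (big_cat_nat (n := n)) //=.
rewrite addrAC subrr add0r; apply: le_trans (ler_norm_sum _ _ _) _.
by apply: geometric_tail nm => k; apply: (term_bound (cB k) zr).
Qed.

(** For r >= 1 one has r^k <= r^(2k) = r^(k - j) r^(k + j), which splits between the two factors of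
    each product. *)
Lemma lopn_norm p (b : nat -> C) r B k : 1 <= r -> (forall i, `|b i| * r ^+ i <= B) ->
  `|lopn p b k| * r ^+ k <=
  ('C((2 * p).-1, p)%:R + \sum_(1 <= j < p.+1) 'C(2 * p, p - j)%:R) * B ^+ 2.
Proof.
move=> r1 bB; have r0 : 0 <= r by apply: le_trans r1.
have B0 : 0 <= B by apply: le_trans (bB 0); rewrite mulr_ge0 ?exprn_ge0.
have bb i j : (i + j = k.*2)%N -> `|b i| * `|b j| * r ^+ k <= B ^+ 2.
  move=> ij; apply: (@le_trans _ _ (`|b i| * `|b j| * r ^+ k.*2)).
    by rewrite ler_wpM2l ?mulr_ge0 // ler_weXn2l // -addnn leq_addr.
  by rewrite -ij exprD mulrACA expr2 ler_pM ?mulr_ge0 ?exprn_ge0.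
apply: (@le_trans _ _ ('C((2 * p).-1, p)%:R * (`|b k| * `|b k| * r ^+ k) +
  \sum_(1 <= j < p.+1) 'C(2 * p, p - j)%:R *
    ((if (j <= k)%N then `|b (k - j)%N| else 0) * `|b (k + j)%N| * r ^+ k))).
  have -> : forall x y z : C, x * (y * z) + \sum_(1 <= j < p.+1) 'C(2 * p, p - j)%:R *
    ((if (j <= k)%N then `|b (k - j)%N| else 0) * `|b (k + j)%N| * z) =
    (x * y + \sum_(1 <= j < p.+1) 'C(2 * p, p - j)%:R *
    ((if (j <= k)%N then `|b (k - j)%N| else 0) * `|b (k + j)%N|)) * z.
    by move=> x y z; rewrite mulrDl mulrA mulr_suml; congr (_ + _); apply: eq_bigr => j _; rewrite !mulrA.
  rewrite ler_wpM2r ?exprn_ge0 // (le_trans (ler_normD _ _)) // lerD //.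
    by rewrite normrM normr_nat normrX expr2.
  apply: le_trans (ler_norm_sum _ _ _) _; apply: ler_sum => j _.
  rewrite !normrM normrX normrN1 expr1n mul1r normr_nat mulrA.
  by case: ifP => _; rewrite ?normr0.
rewrite mulrDl; apply: lerD; first by rewrite ler_wpM2l // bb // addnn.
rewrite mulr_suml; apply: ler_sum => j _; rewrite ler_wpM2l //.
case: ifP => jk; last by rewrite !mul0r exprn_ge0.
by rewrite bb // addnCA subnK // addnn.
Qed.

Definition shift_coef c k : C := k.+1%:R * c k.+1.

Lemma entire_shift c : entire_coef c -> entire_coef (shift_coef c).
Proof.
(* The factor 2 in the radius absorbs k + 1 <= 2^(k + 1); the summand 1 absorbs the extra power. *)
move=> ec r r0; have [B cB] := ec (2 * (r + 1)) (mulr_ge0 (ler0n _ 2) (addr_ge0 r0 ler01)).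
exists B => k; apply: le_trans (cB k.+1).
rewrite /shift_coef normrM normr_nat [_ * `|c _|]mulrC -mulrA ler_wpM2l // exprMn.
apply: ler_pM; rewrite ?exprn_ge0 //.
  by rewrite -natrX ler_nat ltnW // ltn_expl.
apply: (@le_trans _ _ ((r + 1) ^+ k)).
  by apply: lerXn2r; rewrite ?nnegrE ?addr_ge0 // lerDl.
by rewrite ler_weXn2l // lerDr.
Qed.

Lemma taylor_remainder (z h : C) k : `|h| <= 1 ->
  `|(z + h) ^+ k - z ^+ k - h * (k%:R * z ^+ k.-1)| <=
  `|h| ^+ 2 * (2 * (`|z| + 1)) ^+ k.
Proof.
move=> h1; elim: k => [|k IH].
  by rewrite !expr0 subrr mul0r mulr0 subr0 normr0 mulr_ge0.
set rho := `|z| + 1 in IH *; have rho1 : 1 <= rho by rewrite lerDr.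
have rho0 : 0 <= rho by apply: le_trans rho1.
have -> : (z + h) ^+ k.+1 - z ^+ k.+1 - h * (k.+1%:R * z ^+ k.+1.-1) =
   (z + h) * ((z + h) ^+ k - z ^+ k - h * (k%:R * z ^+ k.-1)) + h ^+ 2 * (k%:R * z ^+ k.-1).
  case: k {IH} => [|k]; first by rewrite /= !expr0 expr1; ring.
  by rewrite /= -[k.+2%:R]natr1 !exprS; ring.
apply: le_trans (ler_normD _ _) _; rewrite !normrM !normrX.
have le1 : `|z + h| <= rho by rewrite (le_trans (ler_normD _ _)) // lerD2l.
apply: (@le_trans _ _ (rho * (`|h| ^+ 2 * (2 * rho) ^+ k) + `|h| ^+ 2 * (2 ^+ k * rho ^+ k.+1))).
  apply: lerD; first by rewrite ler_pM.
  rewrite ler_wpM2l ?exprn_ge0 // ler_pM ?exprn_ge0 //.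
    by rewrite normr_nat -natrX ler_nat ltnW // ltn_expl.
  apply: (@le_trans _ _ (rho ^+ k.-1)).
    by apply: lerXn2r; rewrite ?nnegrE // lerDl.
  by rewrite ler_weXn2l // (leq_trans (leq_pred _)).
rewrite le_eqVlt; apply/orP; left; apply/eqP.
by rewrite !exprMn !exprS; ring.
Qed.

End PowerSums.

Section EntireSeries.
Variable R : realType.
Local Notation C := R[i].
Implicit Types (c : nat -> C).

Lemma clim_geometric (B e : C) : 0 <= B -> 0 < e ->
  exists N, forall n, (N <= n)%N -> 2 * B / 2 ^+ n <= e.
Proof.
move=> B0 e0; have x0 : 0 <= 2 * B / e by rewrite divr_ge0 ?mulr_ge0 // ltW.
have xE : 2 * B / e = (complex.Re (2 * B / e))%:C by rewrite RRe_real // ger0_real.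
exists (Num.bound (complex.Re (2 * B / e))) => n Nn.
rewrite ler_pdivrMr ?exprn_gt0 // [e * _]mulrC -ler_pdivrMr // xE.
apply: (@le_trans _ _ (n%:R)); last by rewrite -natrX ler_nat ltnW // ltn_expl.
have -> : n%:R = (n%:R : R)%:C :> C by rewrite rmorph_nat.
rewrite lecR.
apply: le_trans (ltW (archi_boundP _)) _; first by rewrite -ler0c -xE.
by rewrite ler_nat.
Qed.

(** Real and imaginary parts are dominated by a geometric series and converge separately by
    comparison in [R]. *)
Lemma entire_cvg c z : entire_coef c -> exists l, clim (psum c z) l.
Proof.
move=> ec; have [B cB] := ec (2 * `|z|) (mulr_ge0 (ler0n _ 2) (normr_ge0 z)).
have uB k : `|c k * z ^+ k| * 2 ^+ k <= B by apply: (term_bound (cB k)).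
have B0 : 0 <= B by apply: le_trans (uB 0); rewrite mulr_ge0.
have BE : B = (complex.Re B)%:C by rewrite RRe_real // ger0_real.
have BR : 0 <= complex.Re B by rewrite -ler0c -BE.
have abs_cvg (v : nat -> R) : (forall k, `|v k|%:C <= `|c k * z ^+ k|) ->
    exists l : R, clim (fun n => (\sum_(k < n) v k)%:C : C) l%:C.
  move=> vu.
  have : cvgn (series v).
    apply: normed_cvg; apply: (series_le_cvg (v_ := geometric (complex.Re B) 2^-1)).
    - by move=> n; exact: normr_ge0.
    - by move=> n; apply: mulr_ge0 => //; rewrite exprn_ge0 // invr_ge0.
    - move=> k; rewrite /geometric /= exprVn ler_pdivlMr ?exprn_gt0 // -lecR -BE.
      rewrite rmorphM rmorphXn rmorph_nat; apply: le_trans (uB k).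
      by apply: ler_wpM2r; [exact: exprn_ge0 | exact: vu].
    - by apply: is_cvg_geometric_series; rewrite ger0_norm // invf_lt1 // ltr1n.
  move=> /cvg_ex[l vl]; exists l => e e0.
  have eE : e = (complex.Re e)%:C by rewrite RRe_real // gtr0_real.
  move: e0; rewrite eE ltcR => e0.
  have /cvgrPdist_le/(_ _ e0)[N _ h] := vl; exists N => n Nn.
  rewrite -rmorphB normc_def /= expr0n addr0 sqrtr_sqr lecR distrC.
  by have := h n Nn; rewrite /series /= big_mkord.
have [k|lr hr] := abs_cvg (fun k => complex.Re (c k * z ^+ k)).
  exact: normc_ge_Re.
have [k|li hi] := abs_cvg (fun k => complex.Im (c k * z ^+ k)).
  rewrite -[complex.Im _]opprK -ReiNIm normrN (le_trans (normc_ge_Re _)) //.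
  by rewrite normrM complexiE normCi mulr1.
exists (lr%:C + 'i%C * li%:C); apply: clim_eq (climD hr (climMl 'i%C hi)) => n.
rewrite !rmorph_sum mulr_sumr -big_split; apply: eq_bigr => k _.
by rewrite [RHS]complexE.
Qed.

(** A term is a difference of consecutive partial sums at r; once both are within 1 of the limit it
    is at most 2, and the finitely many earlier terms are added to the bound. *)
Lemma cvg_entire c : (forall z, exists l, clim (psum c z) l) -> entire_coef c.
Proof.
move=> cc r r0; have [l cl] := cc r.
have [N h] := cl 1 ltr01.
have h2 k : (N <= k)%N -> `|c k| * r ^+ k <= 2.
  move=> Nk; have := h k.+1 (leqW Nk); have := h k Nk.
  rewrite /psum big_ord_recr /= -/(psum c r k); set s := psum c r k => le1 le2.
  have -> : `|c k| * r ^+ k = `|c k * r ^+ k| by rewrite normrM (ger0_norm (exprn_ge0 k r0)).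
  have -> : c k * r ^+ k = (s + c k * r ^+ k - l) - (s - l) by ring.
  by rewrite (le_trans (ler_normB _ _)) // -[2]/(1 + 1) lerD.
exists (2 + \sum_(k < N) `|c k| * r ^+ k) => k.
have s0 : 0 <= \sum_(k < N) `|c k| * r ^+ k by rewrite sumr_ge0 // => i _; rewrite mulr_ge0 ?exprn_ge0.
have [kN|Nk] := ltnP k N; last by rewrite (le_trans (h2 k Nk)) // lerDl.
rewrite (bigD1 (Ordinal kN)) //= addrCA lerDl addr_ge0 //.
by rewrite sumr_ge0 // => i _; rewrite mulr_ge0 ?exprn_ge0.
Qed.

Lemma entire_derive c (f f' : R[i]^o -> R[i]^o) z : entire_coef c ->
  (forall z, clim (psum c z) (f z)) ->
  (forall z, clim (psum (shift_coef c) z) (f' z)) ->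
  derivable f z 1 /\ derive1 f z = f' z.
Proof.
(* [rho] is the base appearing in [taylor_remainder]; the coefficient bound is taken at [2 * rho] to
   sum the remainders geometrically. *)
move=> ec cf cf'; pose rho := 2 * (`|z : C| + 1).
have rho0 : 0 <= rho by rewrite mulr_ge0 // addr_ge0.
have [B cB] := ec (2 * rho) (mulr_ge0 (ler0n _ 2) rho0).
have B0 : 0 <= B by apply: le_trans (cB 0); rewrite mulr_ge0.
apply: (@quadratic_derivable _ f z (f' z) (2 * B)); first by rewrite mulr_ge0.
move=> h h1; pose D k : C := c k * ((z + h) ^+ k - z ^+ k - h * (k%:R * z ^+ k.-1)).
have lim : clim (fun n => \sum_(k < n.+1) D k) (f (z + h) - f z - h * f' z).
  have l1 := clim_shift 1 (cf (z + h)).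
  have l2 := climMl (-1) (clim_shift 1 (cf z)).
  have l3 := climMl (- h) (cf' z).
  have -> : f (z + h) - f z - h * f' z = f (z + h) + -1 * f z + - h * f' z.
    by rewrite mulN1r mulNr.
  apply: clim_eq (climD (climD l1 l2) l3) => n; rewrite addn1.
  have -> : psum (shift_coef c) z n = \sum_(k < n.+1) c k * (k%:R * z ^+ k.-1).
    rewrite big_ord_recl [X in X + _](_ : _ = 0) ?add0r; last by rewrite mul0r mulr0.
    apply: eq_bigr => k _.
    by rewrite lift0 /shift_coef; ring.
  rewrite /psum !mulr_sumr -!big_split; apply: eq_bigr => k _ /=.
  by rewrite /D; ring.
apply: (clim_norm_le (N := 0) lim) => n _.
apply: le_trans (ler_norm_sum _ _ _) _.
apply: (@le_trans _ _ (\sum_(k < n.+1) `|h| ^+ 2 * (`|c k| * rho ^+ k))).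
  apply: ler_sum => k _; rewrite normrM [X in _ <= X]mulrCA ler_wpM2l //.
  exact: taylor_remainder.
rewrite -mulr_sumr ler_wpM2l ?exprn_ge0 //.
have cB' k : `| `|c k| | * (2 * rho) ^+ k <= B by rewrite normr_id.
have rhoE : `|rho| <= rho by rewrite ger0_norm.
apply: le_trans (psum_norm n.+1 cB' rhoE).
rewrite ger0_norm ?lexx // /psum sumr_ge0 // => k _.
by rewrite mulr_ge0 ?exprn_ge0.
Qed.

(** The default 0 is taken only where the series diverges. *)
Definition entire_sum c (z : C) : C := xget 0 [set l | clim (psum c z) l].

Lemma entire_sumP c z : entire_coef c -> clim (psum c z) (entire_sum c z).
Proof. by move=> /(entire_cvg z)[l cl]; apply: (xgetPex 0 (ex_intro _ l cl)). Qed.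

Lemma derive1n_entire k c (f : R[i]^o -> R[i]^o) : entire_coef c ->
  (forall z, clim (psum c z) (f z)) -> derive1n k f 0 = k`!%:R * c k.
Proof.
elim: k c f => [|k IH] c f ec cf.
  rewrite fact0 mul1r; apply: (clim_unique (cf 0)).
  move=> e e0; exists 1%N => -[//|n] _.
  rewrite /psum big_ord_recl big1 ?addr0 => [|i _]; last by rewrite expr0n mulr0.
  by rewrite expr0 mulr1 subrr normr0 ltW.
have ec' := entire_shift ec.
have dE : derive1 f = entire_sum (shift_coef c).
  apply/funext => z; have [] := entire_derive z ec cf (fun z => entire_sumP z ec').
  by [].
rewrite /derive1n iterSr -/(derive1n k _) dE.
rewrite (IH _ _ ec' (fun z => entire_sumP z ec')) /shift_coef factS natrM.
by rewrite mulrCA mulrA.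
Qed.

Lemma taylor_coef_entire k c (f : R[i]^o -> R[i]^o) : entire_coef c ->
  (forall z, clim (psum c z) (f z)) -> taylor_coef f k = c k.
Proof.
move=> ec cf; rewrite /taylor_coef (derive1n_entire k ec cf) mulrAC divff ?mul1r //.
Qed.

(** A three-term estimate: the common bound [B] makes both tails beyond [K] small uniformly in n and
    z, and the first [K] coefficients converge. *)
Lemma entire_uniform_limit (b : nat -> nat -> C) c (f : C -> C) (P : nat -> {poly C}) r :
  0 <= r ->
  (exists B, forall n k, `|b n k| * (2 * r) ^+ k <= B) ->
  (forall k, clim (fun n => b n k) (c k)) ->
  (forall n k, (P n)`_k = b n k) ->
  (forall z, clim (psum c z) (f z)) ->
  forall e, 0 < e -> exists N, forall n, (N <= n)%N ->
    forall z, `|z| <= r -> `|(P n).[z] - f z| <= e.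
Proof.
move=> r0 [B bB] bc Pb cf e e0.
have cB k : `|c k| * (2 * r) ^+ k <= B.
  have r2 : 0 <= (2 * r) ^+ k by rewrite exprn_ge0 // mulr_ge0.
  rewrite -[X in _ * X]ger0_norm // -normrM mulrC.
  apply: (clim_norm_le (N := 0) (climMl ((2 * r) ^+ k) (bc k))) => n _.
  by rewrite normrM ger0_norm // mulrC.
have B0 : 0 <= B by apply: le_trans (cB 0); rewrite mulr_ge0 // exprn_ge0 // mulr_ge0.
have e30 : 0 < e / 3%:R by rewrite divr_gt0 // ltr0n.
have [K hK] := clim_geometric B0 e30.
have [N hN] : exists N, forall n, (N <= n)%N ->
    \sum_(k < K) `|b n k - c k| * r ^+ k <= e / 3%:R.
  have h : clim (fun n => \sum_(k < K) r ^+ k * `|b n k - c k|) (\sum_(k < K) r ^+ k * 0).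
    apply: clim_sum => k; apply: climMl => e' /(bc k)[N h].
    by exists N => n /h; rewrite subr0 normr_id.
  have [N hN] := h _ e30; exists N => n /hN.
  rewrite [X in _ - X]big1 ?subr0 => [|k _]; last by rewrite mulr0.
  rewrite ger0_norm; last by apply: sumr_ge0 => k _; rewrite mulr_ge0 ?exprn_ge0.
  by under eq_bigr do rewrite mulrC.
exists N => n Nn z zr.
have Pz : clim (psum (b n) z) (P n).[z].
  move=> e' e'0; exists (size (P n)) => m sm.
  rewrite (horner_coef_wide _ sm) /psum.
  rewrite (eq_bigr (fun k : 'I_m => (P n)`_k * z ^+ k)) => [|k _]; last by rewrite Pb.
  by rewrite subrr normr0 ltW.
have t1 := psum_tail K (bB n) zr Pz.
have t2 := psum_tail K cB zr (cf z).
have t3 : `|psum (b n) z K - psum c z K| <= e / 3%:R.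
  apply: le_trans (hN n Nn); rewrite /psum -sumrB; apply: le_trans (ler_norm_sum _ _ _) _.
  apply: ler_sum => k _; rewrite -mulrBl normrM normrX ler_wpM2l //.
  by apply: lerXn2r; rewrite ?nnegrE.
have -> : (P n).[z] - f z = ((P n).[z] - psum (b n) z K) - (f z - psum c z K)
    + (psum (b n) z K - psum c z K) by ring.
have -> : e = e / 3%:R + e / 3%:R + e / 3%:R by field.
apply: le_trans (ler_normD _ _) _; apply: lerD => //.
apply: le_trans (ler_normB _ _) _; apply: lerD.
  exact: le_trans t1 (hK K (leqnn K)).
exact: le_trans t2 (hK K (leqnn K)).
Qed.

End EntireSeries.

Section MoreLimits.
Variable C : numFieldType.
Implicit Types (u v : nat -> C) (l m : C).

Lemma climM u v l m : clim u l -> clim v m -> clim (fun n => u n * v n) (l * m).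
Proof.
move=> ul vm e e0.
have k1 : 0 < `|l| + 1 by rewrite ltr_wpDl.
have k2 : 0 < `|m| + 1 by rewrite ltr_wpDl.
have e20 : 0 < e / 2 by rewrite divr_gt0.
have [N1 h1] := ul _ ltr01.
have [N2 h2] := vm _ (divr_gt0 e20 k1).
have [N3 h3] := ul _ (divr_gt0 e20 k2).
exists (maxn N1 (maxn N2 N3)) => n; rewrite !geq_max => /and3P[/h1 le1 /h2 le2 /h3 le3].
have uB : `|u n| <= `|l| + 1.
  by rewrite -[u n](subrK l) (le_trans (ler_normD _ _)) // addrC lerD2l.
have -> : u n * v n - l * m = u n * (v n - m) + (u n - l) * m by ring.
have -> : e = e / 2 + e / 2 by field.
apply: le_trans (ler_normD _ _) _; rewrite !normrM; apply: lerD.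
  rewrite -[X in _ <= X](@divfK _ (`|l| + 1)) ?gt_eqF // mulrC.
  by apply: ler_pM.
rewrite -[X in _ <= X](@divfK _ (`|m| + 1)) ?gt_eqF //.
by apply: ler_pM => //; rewrite lerDl.
Qed.

Lemma clim_ge0 u l : l \is Num.real -> clim u l -> (forall n, 0 <= u n) -> 0 <= l.
Proof.
move=> lR ul u0; rewrite real_leNgt ?real0 //; apply/negP => l0.
have e0 : 0 < - l / 2 by rewrite divr_gt0 // oppr_gt0.
have [N /(_ N (leqnn N))] := ul _ e0.
rewrite ger0_norm ?addr_ge0 ?oppr_ge0 ?(ltW l0) // => le1.
have : - l <= - l / 2 by apply: le_trans le1; rewrite lerDr.
move=> /le_lt_trans lt; suff /lt : - l / 2 < - l by rewrite ltxx.
by rewrite ltr_pdivrMr // ltr_pMr ?oppr_gt0 // ltr1n.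
Qed.

Lemma clim_lopn p (b : nat -> nat -> C) (c : nat -> C) k :
  (forall i, clim (fun n => b n i) (c i)) ->
  clim (fun n => lopn p (b n) k) (lopn p c k).
Proof.
move=> bc; rewrite /lopn; apply: climD.
  by apply: climMl; rewrite expr2; apply: clim_eq (climM (bc k) (bc k)) => n; rewrite expr2.
apply: clim_sum => j; apply: climM => //; apply: climMl.
by case: ifP => _ //; exact: clim_cst.
Qed.

End MoreLimits.

Lemma clim_real (C : numClosedFieldType) (u : nat -> C) l :
  clim u l -> (forall n, u n \is Num.real) -> l \is Num.real.
Proof.
move=> ul uR; apply/CrealP; apply: (clim_unique (u := u)) => // e /ul[N h].
exists N => n /h; rewrite -norm_conjC rmorphB /= conj_Creal //.
Qed.

(** * Compact subsets of the complex plane *)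

Section ComplexCompact.
Variable R : realType.
Local Notation C := R[i].

Lemma complex_pair_continuous :
  continuous (fun x : R * R => x.1%:C + 'i%C * x.2%:C : R[i]^o).
Proof.
move=> [x y]; apply/cvgrPdist_le => e e0.
have eE : e = (complex.Re e)%:C by rewrite RRe_real // gtr0_real.
have d0 : 0 < complex.Re e / 2 by rewrite divr_gt0 // -ltcR -eE.
exists ([set t | `|x - t| <= complex.Re e / 2], [set t | `|y - t| <= complex.Re e / 2]).
  by split; [apply: filterS (nbhsx_ballx x _ d0) | apply: filterS (nbhsx_ballx y _ d0)] => u; rewrite -ball_normE => /ltW.
move=> [s t] /= [xs yt].
have normE (u : R) : `|u%:C : R[i]| = `|u|%:C.
  by rewrite normc_def /= expr0n addr0 sqrtr_sqr.
have -> : x%:C + 'i%C * y%:C - (s%:C + 'i%C * t%:C) = (x - s)%:C + 'i%C * (y - t)%:C :> R[i].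
  by rewrite !rmorphB; ring.
apply: le_trans (ler_normD _ _) _.
rewrite normrM complexiE normCi mul1r !normE -rmorphD eE lecR.
by rewrite [complex.Re e]splitr lerD.
Qed.

Lemma compact_unit_box : exists2 K : set R[i]^o, compact K &
  forall z : R[i]^o, `|z| <= 1 -> K z.
Proof.
pose g (x : R * R) : R[i]^o := x.1%:C + 'i%C * x.2%:C.
exists (g @` (`[-1, 1]%classic `*` `[-1, 1]%classic)).
  apply: continuous_compact; last by apply: compact_setX; exact: segment_compact.
  exact/continuous_subspaceT/complex_pair_continuous.
move=> z z1; exists (complex.Re z, complex.Im z) => /=; last by rewrite /g [RHS]complexE.
have re1 : `|complex.Re z| <= 1.
  by rewrite -lecR rmorph1 (le_trans (normc_ge_Re _)).
have im1 : `|complex.Im z| <= 1.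
  rewrite -lecR rmorph1 -[complex.Im z]opprK -ReiNIm normrN (le_trans (normc_ge_Re _)) //.
  by rewrite normrM complexiE normCi mulr1.
by rewrite !in_itv /= -!ler_norml.
Qed.

Lemma compact_complex_bounded (K : set R[i]^o) : compact K ->
  exists2 r : C, 0 <= r & forall z, K z -> `|z : C| <= r.
Proof.
pose g (z : R[i]^o) : R := complex.Re `|z : C|.
have gE z : `|z : C| = (g z)%:C by rewrite RRe_real // ger0_real.
have cg : continuous g.
  move=> z A /nbhs_ballP[e e0 eA]; have e0' : 0 < e%:C :> R[i] by rewrite ltcR.
  apply/nbhs_ballP; exists e%:C => //= t; rewrite -ball_normE => zt.
  apply: eA; rewrite -ball_normE /= -ltcR; apply: le_lt_trans zt.
  have -> : `|g z - g t|%:C = `| `|z : C| - `|t : C| |.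
    by rewrite !gE -rmorphB [RHS]normc_def /= expr0n addr0 sqrtr_sqr.
  exact: ler_dist_dist.
move=> cK; have : compact (g @` K).
  by apply: continuous_compact => //; exact: continuous_subspaceT.
move=> /compact_bounded[M [_ hM]]; exists (`|M| + 1)%:C.
  by rewrite ler0c addr_ge0.
move=> z Kz; rewrite gE lecR.
apply: le_trans (ler_norm _) _; apply: (hM (`|M| + 1)); last by exists z.
by rewrite (le_lt_trans (ler_norm M)) // ltrDl.
Qed.

End ComplexCompact.

(** * From the class to coefficients and back *)

Section Assembly.
Variable R : realType.
Local Notation C := R[i].
Implicit Type a : nat -> R.

Lemma power_seriesE a (z : C) n : power_series a z n = psum (fun k => (a k)%:C) z n.
Proof. by rewrite /power_series /series /= big_mkord. Qed.

(** Cauchy's estimate applies to polynomials, so the limit function is replaced by a truncation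
    beyond degree [k], uniformly close to it on the unit disc. *)
Lemma coef_clim a (phi : R[i]^o -> R[i]^o) (Q : nat -> {poly R}) :
  entire_coef (fun k => (a k)%:C : C) ->
  (forall z, clim (psum (fun k => (a k)%:C) z) (phi z)) ->
  (forall e : C, 0 < e -> exists N, forall n, (N <= n)%N ->
     forall z : C, `|z| <= 1 -> `|(complex_poly (Q n)).[z] - phi z| <= e) ->
  forall k, clim (fun m => ((Q m)`_k)%:C : C) (a k)%:C.
Proof.
move=> ec cphi Qphi k e e0; have e20 : 0 < e / 2 by rewrite divr_gt0.
have [N hN] := Qphi _ e20; exists N => n /hN le1.
have [B cB] := ec (2 * 1) (mulr_ge0 (ler0n _ 2) ler01).
have B0 : 0 <= B by apply: le_trans (cB 0); rewrite mulr_ge0.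
have [M hM] := clim_geometric B0 e20.
pose m := maxn M k.+1; have km : (k < m)%N by rewrite leq_maxr.
pose d := complex_poly (Q n) - \poly_(i < m) (a i)%:C.
have -> : ((Q n)`_k)%:C - (a k)%:C = d`_k.
  by rewrite coefB coef_map coef_poly km.
apply: poly_cauchy => z z1.
have -> : d.[z] = ((complex_poly (Q n)).[z] - phi z) + (phi z - psum (fun k => (a k)%:C) z m).
  by rewrite addrA subrK hornerD hornerN; congr (_ - _); exact: horner_poly.
have -> : e = e / 2 + e / 2 by field.
apply: le_trans (ler_normD _ _) (lerD (le1 z z1) _).
by apply: le_trans (psum_tail m cB z1 (cphi z)) (hM m _); rewrite leq_maxl.
Qed.

Lemma jensen_le a n k : 0 <= a k -> `|(jensen a n k)%:C : C| <= `|(a k)%:C : C|.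
Proof.
move=> a0; rewrite /jensen rmorphM normrM ler_piMr //.
by rewrite ger0_norm ?ler0c ?falling_ratio_ge0 // lecR falling_ratio_le1.
Qed.

End Assembly.

Theorem theorem19 (R : realType) (p : nat) (gamma a : nat -> R)
    (phi : R[i]^o -> R[i]^o)
    (p_gt0 : (0 < p)%N)
    (aE : forall k : nat, a k = gamma k / k`!%:R)
    (phiE : forall z : R[i]^o, power_series a z n @[n --> \oo] --> phi z)
    (phiLP : LPplus phi) :
  (forall z : R[i]^o, cvgn (power_series (Lop p a) z)) /\
  LPplus (fun z : R[i]^o => limn (power_series (Lop p a) z)).
Proof.
case: phiLP => -[[_ _] [Q [QR Qphi]]] tphi.
pose ac k : R[i] := (a k)%:C.
have cphi z : clim (psum ac z) (phi z).
  by apply: clim_eq (iffLR (cvg_clim _ _) (phiE z)) => n; rewrite power_seriesE.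
have ec : entire_coef ac by apply: cvg_entire => z; exists (phi z).
have a0 k : 0 <= a k by rewrite -ler0c -/(ac k) -(taylor_coef_entire k ec cphi).
have Qa k : clim (fun m => ((Q m)`_k)%:C : R[i]) (a k)%:C.
  apply: (coef_clim ec cphi) => e e0.
  have [K cK Kdisc] := compact_unit_box R.
  have [N h] := iffLR (uniform_clim _ _ _) (Qphi K cK) e e0.
  by exists N => n Nn z z1; apply: h => //; exact: Kdisc.
pose lc k : R[i] := (Lop p a k)%:C.
have lcE k : lc k = lopn p ac k by rewrite /lc LopE lopn_complex.
pose b n k : R[i] := (Lop p (jensen a n.+1) k)%:C.
have bE n k : b n k = lopn p (fun i => (jensen a n.+1 i)%:C) k.
  by rewrite /b LopE lopn_complex.
have bB r : 0 <= r -> exists B, forall n k, `|b n k| * r ^+ k <= B.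
  (* [lopn_norm] requires a radius at least 1, hence r + 1; domination by [a] makes the bound
     independent of n. *)
  move=> r0; have r1 : 1 <= r + 1 by rewrite lerDr.
  have [B aB] := ec (r + 1) (addr_ge0 r0 ler01).
  eexists => n k; rewrite bE.
  have jB i : `|(jensen a n.+1 i)%:C : R[i]| * (r + 1) ^+ i <= B.
    apply: le_trans (aB i); rewrite ler_wpM2r ?exprn_ge0 ?addr_ge0 //.
    exact: jensen_le.
  apply: le_trans _ (lopn_norm p k r1 jB).
  apply: ler_wpM2l => //; apply: lerXn2r; rewrite ?nnegrE ?addr_ge0 //.
  by rewrite lerDl.
have bc k : clim (fun n => b n k) (lc k).
  rewrite lcE; apply: clim_eq (clim_lopn p k (b := fun n i => (jensen a n.+1 i)%:C) _) => [n|i].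
    by rewrite bE.
  rewrite -[ac i]mulr1.
  by apply: clim_eq (climMl _ (@clim_falling_ratio R i)) => n; rewrite /ac -rmorphM.
have elc : entire_coef lc.
  move=> r r0; have [B h] := bB r r0; exists B => k.
  have r2 : 0 <= r ^+ k by rewrite exprn_ge0.
  rewrite -[X in _ * X]ger0_norm // -normrM mulrC.
  apply: (clim_norm_le (N := 0) (climMl (r ^+ k) (bc k))) => n _.
  by rewrite normrM ger0_norm // mulrC.
have cv z : power_series (Lop p a) z n @[n --> \oo] --> (entire_sum lc z : R[i]^o).
  apply/cvg_clim; apply: clim_eq (entire_sumP z elc) => n.
  by rewrite power_seriesE.
have limE : (fun z : R[i]^o => limn (power_series (Lop p a) z)) = entire_sum lc.
  by apply/funext => z; apply: cvg_lim (cv z); exact: norm_hausdorff.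
rewrite limE; split; first by move=> z; apply/cvg_ex; eexists; exact: cv.
have clc z := entire_sumP z elc.
have clc' z := entire_sumP z (entire_shift elc).
split; last first.
  move=> k; rewrite (taylor_coef_entire k elc clc).
  apply: clim_ge0 (bc k) _; first by apply/complex_realP; exists (Lop p a k).
  by move=> n; rewrite ler0c; exact: (lop_jensen_ge0 a0 QR Qa).
split; first split.
- by move=> z; case: (entire_derive z elc clc clc').
- move=> x; apply: clim_real (clc x%:C) _ => n; apply: rpred_sum => k _.
  by rewrite -rmorphXn -rmorphM; apply/complex_realP; eexists.
(* Adding a small constant where the polynomial is zero makes it real rooted. *)
pose eps n : R := if jensen_poly a n.+1 == 0 then 2 * 1 / 2 ^+ n else 0.
exists (fun n => lop_jensen_poly a p n.+1 + (eps n)%:P); split.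
  move=> n z; rewrite /eps; have [J0|J0] := eqVneq (jensen_poly a n.+1) 0.
    have j0 i : (jensen a n.+1 i)%:C = 0 :> R[i] by rewrite -coef_jensen_poly J0 coef0.
    have -> : lop_jensen_poly a p n.+1 = 0.
      apply/polyP => k; rewrite coef0 coef_lop_jensen_poly; apply: complexI.
      by rewrite -/(b n k) bE rmorph0 lopn_top => [|l _]; rewrite j0 // expr0n mulr0.
    rewrite add0r /complex_poly map_polyC rootC fmorph_eq0 mulr1.
    by rewrite mulf_eq0 invr_eq0 expf_eq0 pnatr_eq0 andbF.
  rewrite addr0 => /(lop_jensen_roots a0 QR Qa p_gt0 J0).
  exact: ler0_real.
move=> K cK; have [r r0 Kr] := compact_complex_bounded cK.
apply/uniform_clim => e e0; have e20 : 0 < e / 2 by rewrite divr_gt0.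
have Pb n k : (complex_poly (lop_jensen_poly a p n.+1))`_k = b n k.
  by rewrite coef_map coef_lop_jensen_poly.
have [N1 h1] := entire_uniform_limit r0 (bB (2 * r) (mulr_ge0 (ler0n _ 2) r0)) bc Pb clc e20.
(* The correction [eps] was given the shape 2 * 1 / 2^n so that this bound with B = 1 applies. *)
have [N2 h2] := clim_geometric (@ler01 R[i]) e20.
exists (maxn N1 N2) => n; rewrite geq_max => /andP[/h1 le1 /h2 le2] z Kz.
rewrite /complex_poly rmorphD /= map_polyC hornerD hornerC addrAC.
have -> : e = e / 2 + e / 2 by field.
apply: le_trans (ler_normD _ _) _; apply: lerD; first exact: le1 (Kr z Kz).
apply: le_trans le2; have eps2 : 0 <= 2 * 1 / 2 ^+ n :> R[i].
  by rewrite divr_ge0 // exprn_ge0.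
suff : `|(eps n)%:C : R[i]| <= 2 * 1 / 2 ^+ n by [].
rewrite /eps; case: ifP => _; last by rewrite rmorph0 normr0.
by rewrite !rmorphM fmorphV rmorphXn rmorph1 rmorph_nat ger0_norm.
Qed.
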